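(* Let $\mathcal L$ be a good cocycle and let $\varphi$ satisfy $\operatorname{ess\,sup}_{\omega\in\Omega}\big(K(\omega)\|\varphi_\omega\|_{BV}\big)<\infty$. Fix some $n\in\mathbb N$ and set $V=\{0,1,\dots,n-1\}$, $X_v=\varphi\circ\tau^v$ for $v\in V$, $\rho(x,y)=|x-y|$, and $\rho(A,B)=\min\{\rho(a,b):a\in A,b\in B\}$ for $A,B\subset V$. For $b>0$ let $$\gamma_b=e^{-(\lambda-\varepsilon)b/3}+\alpha_{[b/3]},$$ and for every $v\in V$ let $$\varrho_{v,\infty}=\varrho:=A_0\max\Big(\operatorname{ess\,sup}_{\omega\in\Omega}\big(K(\omega)\|\varphi_\omega\|_{BV}\big),\ \|\varphi\|_{L^\infty}\Big).$$ There is a choice of the constant $A_0$, depending only on $\lambda-3\varepsilon$ and on a constant $C$ such that $\sup|g|\le C\|g\|_{BV}$ for every function $g:X\to\mathbb C$, for which the following holds: for all $k\ge1$, $b>0$ and every finite collection $(A_j)_{j\in\mathcal J}$ of nonempty subsets of $V$ with $\min_{i\ne j}\rho(A_i,A_j)\ge b$ and $r:=\sum_{j\in\mathcal J}|A_j|\le k$, $$\left|\mathbb E_\mu\Big[\prod_{j\in\mathcal J}\prod_{i\in A_j}X_i\Big]-\prod_{j\in\mathcal J}\mathbb E_\mu\Big[\prod_{i\in A_j}X_i\Big]\right|\le(r-1)\Big(\prod_{j\in\mathcal J}\prod_{i\in A_j}\varrho_{i,\infty}\Big)\gamma_b=(r-1)\,\varrho^{\,r}\,\gamma_b.$$ If in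 addition there are positive constants $c_1,c_2,\eta$ such that $\alpha_n\le c_1e^{-c_2n^\eta}$ for every $n$, then, with $u_0=1$, $c_0=2$ and this $\eta$ (so that $\gamma:=1/\eta=u_0/\eta$), the following conditions also hold: the $X_v$ are centered random variables with $\|X_v\|_{L^\infty}\le\varrho_{v,\infty}$ for all $v\in V$; $$|\{u\in V:\rho(u,v)\le s\}|\le c_0s^{u_0}\quad\text{for all }v\in V\text{ and }s\ge1;$$ and there are constants $a>0$ and $d\ge1$ such that $$\max\{\gamma_q/r:1\le r\le k\}\le de^{-aq^\eta}\quad\text{for all integers }k,q\ge1.$$
   Context: Variation. $(X,\mathcal B,m)$ is a probability space with a notion of variation $\mathrm v:L^1(X,m)\to[0,\infty]$ such that: (V1) $\mathrm v(th)=|t|\mathrm v(h)$; (V2) $\mathrm v(g+h)\le \mathrm v(g)+\mathrm v(h)$; (V3) $\|h\|_{L^\infty}\le C_{\mathrm v}(\|h\|_1+\mathrm v(h))$ for some constant $1\le C_{\mathrm v}<\infty$; (V4) for any $C>0$ the set $\{h:X\to\mathbb R:\|h\|_1+\mathrm v(h)\le C\}$ is $L^1(m)$-compact; (V5) $\mathrm v(\mathbf 1)=0$, where $\mathbf 1$ is the constant function $1$; (V6) $\{h:X\to\mathbb R_+:\|h\|_1=1,\ \mathrm v(h)<\infty\}$ is $L^1(m)$-dense in $\{h:X\to\mathbb R_+:\|h\|_1=1\}$; (V7) if $f\in L^1(X,m)$ and $\operatorname{ess\,inf}f>0$ then $\mathrm v(1/f)\le \mathrm v(f)/(\operatorname{ess\,inf}f)^2$;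 (V8) $\mathrm v(fg)\le\|f\|_{L^\infty}\mathrm v(g)+\|g\|_{L^\infty}\mathrm v(f)$; (V9) for $M>0$, $f:X\to[-M,M]$ measurable and $h:[-M,M]\to\mathbb C$ of class $C^1$, $\mathrm v(h\circ f)\le\|h'\|_{L^\infty}\mathrm v(f)$. $BV=\{g\in L^1(X,m):\mathrm v(g)<\infty\}$ is a Banach space with norm $\|g\|_{BV}=\|g\|_1+\mathrm v(g)$ (set $\|g\|_{BV}=\infty$ if $g\notin BV$); suprema over $X$ are essential suprema. Base map and random maps. $(\xi_n)_{n\in\mathbb Z}$ is a two-sided stationary sequence with values in a measurable space $\mathcal Y$; $\Omega=\mathcal Y^{\mathbb Z}$, $\mathbb P$ is the law of $(\xi_n)$ on $\Omega$, $\sigma((\omega_j)_j)=(\omega_{j+1})_j$ is the left shift, and $(\Omega,\mathcal F,\mathbb P,\sigma)$ is an invertible ergodic measure preserving system. $T_\omega:X\to X$, $\omega\in\Omega$, are non-singular maps ($m\circ T_\omega^{-1}\ll m$) with $T_\omega=T_{\omega_0}$ depending only on the $0$-th coordinate, such that the skew product $\tau(\omega,x)=(\sigma\omega,T_\omega x)$ is measurable. $T_\omega^n=T_{\sigma^{n-1}\omega}\circ\cdots\circ T_\omega$. The transfer operator $\mathcal L_\omega$ on $L^1(X,m)$ is given by $\int(\mathcal L_\omega f)g\,dm=\int f\,(g\circ T_\omega)\,dm$ for $f\in L^1,g\in L^\infty$, and $\mathcal L_\omega^n=\mathcal L_{\sigma^{n-1}\omega}\circ\cdots\circ\mathcal L_\omega$.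 Tempered: a measurable $Q:\Omega\to(0,\infty)$ is tempered if $\lim_{n\to\pm\infty}\frac1n\log Q(\sigma^n\omega)=0$ for $\mathbb P$-a.e. $\omega$. Good cocycle: $\mathcal L=(\mathcal L_\omega)_{\omega\in\Omega}$ is good if: (1) $\Omega$ is a Borel subset of a separable complete metric space, $\sigma$ is a homeomorphism, and $\Omega$ is a countable union of measurable sets on each of which $\omega\mapsto\mathcal L_\omega$ is continuous; (2) there is a tempered $N(\omega)$ with $\mathrm v(g\circ T_\omega)\le N(\omega)\mathrm v(g)$ for a.e. $\omega$ and all $g\in BV$; (3) there is a random variable $C:\Omega\to(0,\infty)$ with $\log C\in L^1(\mathbb P)$ and $\|\mathcal L_\omega h\|_{BV}\le C(\omega)\|h\|_{BV}$ for a.e. $\omega$ and all $h\in BV$; (4) there are $N\in\mathbb N$ and random variables $\alpha^N,K^N:\Omega\to(0,\infty)$ with $\int\log\alpha^N d\mathbb P<0$, $\log K^N\in L^1(\mathbb P)$ and $\mathrm v(\mathcal L^N_\omega h)\le\alpha^N(\omega)\mathrm v(h)+K^N(\omega)\|h\|_1$ for a.e. $\omega$ and all $h\in BV$; (5) for each $a>0$ and a.e. $\omega$ there are a random number $n_c(\omega)<\infty$ and positive random numbers $\alpha_0(\omega),\alpha_1(\omega),\dots$ such that $\operatorname{ess\,inf}_x(\mathcal L_\omega^nh)(x)\ge\alpha_n(\omega)\|h\|_1$ for $n\ge n_c(\omega)$ and every $h\in L^\infty(X,m)$ with $h\ge0$, $\mathrm v(h)\le a\|h\|_1$; (6) $\log(\operatorname{ess\,inf}_x(\mathcal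 L_\omega\mathbf 1)(x))\in L^1(\mathbb P)$. Known facts fixing notation. For a good cocycle there is an essentially unique measurable family $h_\omega\in BV$, $h_\omega\ge0$, $\int h_\omega dm=1$, $\mathcal L_\omega h_\omega=h_{\sigma\omega}$ a.s.; $\|1/h_\omega\|_{BV}$ is tempered. Put $d\mu_\omega=h_\omega dm$, $\mu=\int\mu_\omega\,d\mathbb P(\omega)$ (a $\tau$-invariant probability measure on $\Omega\times X$), and $L_\omega^ng=\mathcal L_\omega^n(gh_\omega)/h_{\sigma^n\omega}$. With $\Pi(\omega)g=g-(\int g\,dm)h_\omega$ and $\tilde\Pi(\omega)g=g-\mu_\omega(g)$, there are $\lambda>0$ and tempered random variables $D,\tilde D$ such that, a.s. and for all $n\in\mathbb N$, $\|\mathcal L_\omega^n\Pi(\omega)\|_{BV}\le D(\omega)e^{-\lambda n}$, $\|\mathcal L^n_\omega(\mathrm{Id}-\Pi(\omega))\|_{BV}\le D(\omega)e^{\epsilon' n}$ (for a fixed $\epsilon'>0$, with $D$ depending on $\epsilon'$), $\|L_\omega^n\tilde\Pi(\omega)\|_{BV}\le\tilde D(\omega)e^{-\lambda n}$, $\|L_\omega^n(\mathrm{Id}-\tilde\Pi(\omega))\|_{BV}\le\tilde D(\omega)$. Set $\tilde K(\omega)=\max(D(\omega),\tilde D(\omega),N(\omega),\|1/h_\omega\|_{BV})$, fix $0<\varepsilon<\lambda/3$, and let $K:\Omega\to(1,\infty)$ be a tempered random variable with $1/K(\omega)\le\tilde K(\omega)\le K(\omega)$ and $K(\omega)e^{-\varepsilon|n|}\le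 K(\sigma^n\omega)\le K(\omega)e^{\varepsilon|n|}$ for a.e. $\omega$ and all $n\in\mathbb Z$ (such $K$ exists). Observable. $\varphi:\Omega\times X\to\mathbb R$ is measurable, $\int\varphi\,d\mu=0$, and $\varphi_\omega=\varphi(\omega,\cdot)$ depends on $\omega$ only through $\omega_0$. $\mathbb E_\mu$ is expectation with respect to $\mu$; $[\cdot]$ is the integer part and $|A|$ the cardinality of a finite set. Mixing. For sub-$\sigma$-algebras $\mathcal A,\mathcal H$ of the probability space with measure $\mathbf P$ on which $(\xi_n)$ is defined, $\alpha(\mathcal A,\mathcal H)=\sup\{|\mathbf P(A\cap B)-\mathbf P(A)\mathbf P(B)|:A\in\mathcal A,B\in\mathcal H\}$, and $\alpha_n=\alpha(\sigma(\xi_j:j\le0),\sigma(\xi_j:j\ge n))$.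
   Formalization: The ball bound is proved with c_0=3 (c_0=2 only for the ball without v), since 2 fails for n≥3, v=1, s=1; the last bound has exponent min(η,1) in place of η, as it fails for η>1; the collection (A_j) is assumed nonempty. *)

(* Defs.v *)
From HB Require Import structures.
From mathcomp Require Import all_boot all_order all_algebra.
From mathcomp Require Import all_classical all_reals all_analysis.
From mathcomp Require Import ess_sup_inf complex.

Set Implicit Arguments.
Unset Strict Implicit.
Unset Printing Implicit Defensive.

Import Order.TTheory GRing.Theory Num.Theory.
Import numFieldNormedType.Exports.

Local Open Scope classical_set_scope.
Local Open Scope ring_scope.
Local Open Scope ereal_scope.

Notation Re := complex.Re.
Notation Im := complex.Im.
Notation normc := Normc.normc.

Section complex_functions.
Context {d : measure_display} {X : measurableType d} {R : realType}.
Variable m : probability X R.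
Implicit Types f g h : X -> R[i].

(* Elements of L^1(X, m) are handled through representatives X -> R[i];
   a real function is identified with its composition with R -> R[i]. *)
Definition real_fun (u : X -> R) : X -> R[i] := fun x => real_complex R (u x).

Definition cabs f : X -> \bar R := fun x => (normc (f x))%:E.

Definition cmeasurable f :=
  measurable_fun setT (fun x => Re (f x)) /\
  measurable_fun setT (fun x => Im (f x)).

Definition norm1 f : \bar R := 'N[m]_1[cabs f].
Definition normoo f : \bar R := 'N[m]_+oo[cabs f].

Definition L1 f := cmeasurable f /\ norm1 f < +oo.
Definition Loo f := cmeasurable f /\ normoo f < +oo.

Definition cint f : R[i] :=
  Complex (\int[m]_x Re (f x))%R (\int[m]_x Im (f x))%R.

Definition essinf (u : X -> R) : \bar R := ess_inf m (fun x => (u x)%:E).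

Definition L1_open (U : set (X -> R[i])) :=
  U `<=` L1 /\
  forall f, U f -> exists2 e : R, (0 < e)%R &
    forall g, L1 g -> norm1 (g \- f)%R < e%:E -> U g.

Definition L1_compact (A : set (X -> R[i])) :=
  A `<=` L1 /\
  forall UU : set (set (X -> R[i])), UU `<=` L1_open ->
    A `<=` \bigcup_(U in UU) U ->
    exists VV, [/\ VV `<=` UU, finite_set VV & A `<=` \bigcup_(U in VV) U].

(* C^1 on [a, b]; at the endpoints the derivative is the continuous extension
   of the derivative on the open interval. *)
Definition C1_on (a b : R) (u u' : R -> R) :=
  [/\ {within `[a, b], continuous u}, {within `[a, b], continuous u'} &
      {in `]a, b[, forall t, is_derive t (1 : R)%R u (u' t)}].

Definition cC1_on (a b : R) (h h' : R -> R[i]) :=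
  C1_on a b (fun t => Re (h t)) (fun t => Re (h' t)) /\
  C1_on a b (fun t => Im (h t)) (fun t => Im (h' t)).

Section variation.
Variable v : (X -> R[i]) -> \bar R.

Definition BV f := L1 f /\ v f < +oo.

Definition bvnorm f : \bar R := if `[< BV f >] then norm1 f + v f else +oo.

Definition opnorm_le (A : (X -> R[i]) -> X -> R[i]) (c : R) :=
  forall g, BV g -> bvnorm (A g) <= c%:E * bvnorm g.

Record is_variation : Prop := IsVariation {
  variation_ge0 : forall f, L1 f -> 0 <= v f ;
  variation_ae : forall f g, L1 f -> L1 g ->
    {ae m, forall x, f x = g x} -> v f = v g ;
  variationZ : forall (t : R[i]) h, L1 h ->
    v (fun x => t * h x)%R = (normc t)%:E * v h ;
  variationD : forall g h, L1 g -> L1 h -> v (g \+ h)%R <= v g + v h ;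
  variation_normoo : exists2 Cv : R, (1 <= Cv)%R &
    forall h, L1 h -> normoo h <= Cv%:E * (norm1 h + v h) ;
  variation_compact : forall c : R, (0 < c)%R ->
    L1_compact [set real_fun h | h in
      [set h : X -> R | L1 (real_fun h) /\
         norm1 (real_fun h) + v (real_fun h) <= c%:E]] ;
  variation_cst1 : v (fun=> 1%R) = 0 ;
  variation_dense : forall h : X -> R, (forall x, 0 <= h x)%R ->
    L1 (real_fun h) -> norm1 (real_fun h) = 1 ->
    forall e : R, (0 < e)%R -> exists h' : X -> R,
      [/\ (forall x, 0 <= h' x)%R, L1 (real_fun h'),
          norm1 (real_fun h') = 1, v (real_fun h') < +oo &
          norm1 (real_fun h \- real_fun h')%R < e%:E] ;
  variationV : forall f : X -> R, L1 (real_fun f) -> 0 < essinf f ->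
    v (real_fun (fun x => (f x)^-1)%R) <=
      v (real_fun f) * ((fine (essinf f) ^+ 2)^-1)%R%:E ;
  variationM : forall f g, L1 f -> L1 g -> L1 (f \* g)%R ->
    v (f \* g)%R <= normoo f * v g + normoo g * v f ;
  variation_comp : forall (M : R) (f : X -> R) (h h' : R -> R[i]),
    (0 < M)%R -> (forall x, - M <= f x <= M)%R ->
    measurable_fun setT f -> cC1_on (- M)%R M h h' ->
    v (fun x => h (f x)) <=
      (sup [set normc (h' t) | t in `[(- M)%R, M]])%:E * v (real_fun f) ;
  BV_complete : forall u : nat -> X -> R[i], (forall k, BV (u k)) ->
    (forall e : R, (0 < e)%R -> exists k0 : nat, forall k l : nat,
       (k0 <= k)%N -> (k0 <= l)%N -> bvnorm (u k \- u l)%R < e%:E) ->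
    exists2 f, BV f & forall e : R, (0 < e)%R -> exists k0 : nat,
      forall k : nat, (k0 <= k)%N -> bvnorm (u k \- f)%R < e%:E }.

End variation.

Definition nonsingular (T : X -> X) :=
  measurable_fun setT T /\
  forall A, measurable A -> m A = 0 -> m (T @^-1` A) = 0.

Definition is_transfer (T : X -> X) (L : (X -> R[i]) -> X -> R[i]) :=
  forall f, L1 f -> L1 (L f) /\
    forall g, Loo g -> cint (L f \* g)%R = cint (f \* (g \o T))%R.

End complex_functions.

Section base.
Context {d : measure_display} (Y : measurableType d).

Definition cylinders : set (set (int -> Y)) :=
  [set A | exists j : int, exists2 B, measurable B &
     A = [set w : int -> Y | B (w j)]].

(* Y^Z with the product sigma-algebra *)
Definition paths := g_sigma_algebraType cylinders.

(* shift n is the n-th power of the left shift, n in Z *)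
Definition shift (n : int) (w : paths) : paths := fun j => w (j + n)%R.

Context {R : realType}.

Section base_measure.
Variable P : probability paths R.

Definition shift_invariant :=
  forall A, measurable A -> P (shift 1 @^-1` A) = P A.

Definition shift_ergodic :=
  forall A, measurable A -> shift 1 @^-1` A = A -> P A = 0 \/ P A = 1.

Definition positive_rv (Q : paths -> R) :=
  measurable_fun setT Q /\ forall w, (0 < Q w)%R.

Definition tempered (Q : paths -> R) :=
  positive_rv Q /\
  {ae P, forall w,
    ((fun n : nat => ln (Q (shift n%:Z w)) / n%:R)%R @ \oo --> (0 : R)%R) /\
    ((fun n : nat => ln (Q (shift (- n%:Z) w)) / - n%:R)%R @ \oo
       --> (0 : R)%R)}.

Definition log_integrable (Q : paths -> R) :=
  P.-integrable setT (fun w => (ln (Q w))%:E).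

End base_measure.

Context {dS : measure_display} {S : measurableType dS}.
Variables (PP : probability S R) (xi : int -> S -> Y).

Definition process_path (s : S) : paths := fun j => xi j s.

Definition is_law (P : probability paths R) :=
  forall A, measurable A -> P A = PP (process_path @^-1` A).

Definition stationary :=
  forall (k : int) (A : set paths), measurable A ->
    PP [set s | A (shift k (process_path s))] = PP (process_path @^-1` A).

Definition sigma_gen (J : set int) : set (set S) :=
  <<s \bigcup_(j in J) preimage_set_system setT (xi j) measurable >>.

Definition alpha_coef (A H : set (set S)) : R :=
  sup [set r | exists a b, [/\ A a, H b &
    r = `|fine (PP (a `&` b)) - fine (PP a) * fine (PP b)|%R]].

Definition alpha (n : nat) : R :=
  alpha_coef (sigma_gen [set j | (j <= 0)%R])
             (sigma_gen [set j | (n%:Z <= j)%R]).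

Definition gamma_ (lambda eps b : R) : R :=
  (expR (- (lambda - eps) * b / 3) + alpha (Num.truncn (b / 3)))%R.

End base.

Section cocycle.
Context {dX : measure_display} {X : measurableType dX}.
Context {dY : measure_display} {Y : measurableType dY} {R : realType}.
Variables (m : probability X R) (P : probability (paths Y) R).
Variable v : (X -> R[i]) -> \bar R.
Variable T : paths Y -> X -> X.
Variable L : paths Y -> (X -> R[i]) -> X -> R[i].

Definition skew_map (z : paths Y * X) : paths Y * X :=
  (shift 1 z.1, T z.1 z.2).

Fixpoint Titer (n : nat) (w : paths Y) (x : X) : X :=
  if n is k.+1 then T (shift k%:Z w) (Titer k w x) else x.

Fixpoint Liter (n : nat) (w : paths Y) (f : X -> R[i]) : X -> R[i] :=
  if n is k.+1 then L (shift k%:Z w) (Liter k w f) else f.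

(* Y^Z carries the topology of a Borel subset of a Polish space E, whose Borel
   sets are measurable for the product sigma-algebra; L is continuous for the
   operator norm of BV on each piece of a countable measurable cover. *)
Definition good_base :=
  exists (E : metricType R) (iota : paths Y -> E),
    let Om := initial_topology iota in
    [/\ (forall F : set_system E, ProperFilter F -> cauchy F ->
          exists x : E, F --> x),
        (exists D : set E, countable D /\ dense D),
        injective iota /\ <<s [set U : set E | open U] >> (range iota),
        (forall U : set E, open U -> measurable (iota @^-1` U)) &
        continuous (shift 1 : Om -> Om) /\ continuous (shift (- 1) : Om -> Om)]
    /\ exists B : nat -> set (paths Y),
        [/\ (forall k, measurable (B k)), \bigcup_k B k = setT &
         forall k w, B k w -> forall e : R, (0 < e)%R ->
           \forall w' \near (w : Om), B k w' ->
             opnorm_le m v (fun h => L w' h \- L w h)%R e].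

Definition composition_bound (N : paths Y -> R) :=
  tempered P N /\
  {ae P, forall w, forall g, BV m v g -> v (g \o T w) <= (N w)%:E * v g}.

Definition good_norm_bound :=
  exists C : paths Y -> R, [/\ positive_rv C, log_integrable P C &
    {ae P, forall w, opnorm_le m v (L w) (C w)}].

(* finiteness of the positive part makes the integral of ln alphaN well defined
   in [-oo, +oo[ *)
Definition good_lasota_yorke :=
  exists (N : nat) (alphaN KN : paths Y -> R),
    [/\ (0 < N)%N, positive_rv alphaN /\ positive_rv KN,
        \int[P]_w (Num.max (ln (alphaN w)) 0)%:E < +oo /\
        \int[P]_w (ln (alphaN w))%:E < 0,
        log_integrable P KN &
        {ae P, forall w, forall h, BV m v h ->
          v (Liter N w h) <= (alphaN w)%:E * v h + (KN w)%:E * norm1 m h}].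

Definition good_covering :=
  forall a : R, (0 < a)%R ->
  exists (nc : paths Y -> nat) (al : nat -> paths Y -> R),
    [/\ measurable_fun setT nc, (forall k, positive_rv (al k)) &
     {ae P, forall w, forall (n : nat) (h : X -> R),
        (nc w <= n)%N -> Loo m (real_fun h) -> (forall x, 0 <= h x)%R ->
        v (real_fun h) <= a%:E * norm1 m (real_fun h) ->
        (al n w)%:E * norm1 m (real_fun h) <=
          essinf m (fun x => Re (Liter n w (real_fun h) x))}].

Definition good_essinf :=
  P.-integrable setT
    (fun w => lne (essinf m (fun x => Re (L w (fun=> 1%R) x)))).

Record good_cocycle : Prop := GoodCocycle {
  good1 : good_base ;
  good2 : exists N, composition_bound N ;
  good3 : good_norm_bound ;
  good4 : good_lasota_yorke ;
  good5 : good_covering ;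
  good6 : good_essinf }.

Section density.
Variable h : paths Y * X -> R.

Definition fiber (w : paths Y) : X -> R := fun x => h (w, x).

Record invariant_density : Prop := InvariantDensity {
  density_measurable : measurable_fun setT h ;
  density_BV : {ae P, forall w, BV m v (real_fun (fiber w))} ;
  density_ge0 : {ae P, forall w, {ae m, forall x, (0 <= fiber w x)%R}} ;
  density_int1 : {ae P, forall w, \int[m]_x (fiber w x)%:E = 1} ;
  density_equivariant : {ae P, forall w, {ae m, forall x,
    L w (real_fun (fiber w)) x = real_fun (fiber (shift 1 w)) x}} }.

(* H is the random variable ||1/h_w||_BV; the first clause makes 1/h_w
   meaningful in spite of the convention 0^-1 = 0 *)
Definition inverse_norm (H : paths Y -> R) :=
  [/\ {ae P, forall w, {ae m, forall x, (0 < fiber w x)%R}},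
      tempered P H &
      {ae P, forall w,
        bvnorm m v (real_fun (fun x => (fiber w x)^-1)%R) = (H w)%:E}].

Definition mu_fiber (w : paths Y) (A : set X) : \bar R :=
  \int[m]_(x in A) (fiber w x)%:E.

Definition is_mu (mu : probability (paths Y * X)%type R) :=
  forall A, measurable A -> mu A = \int[P]_w mu_fiber w (xsection A w).

Definition Pi_op (w : paths Y) (g : X -> R[i]) : X -> R[i] :=
  fun x => (g x - cint m g * real_fun (fiber w) x)%R.

Definition Pit_op (w : paths Y) (g : X -> R[i]) : X -> R[i] :=
  fun x => (g x - cint m (g \* real_fun (fiber w)))%R.

(* the normalized cocycle, denoted L_w^n (as opposed to the calligraphic one) *)
Definition nLiter (n : nat) (w : paths Y) (g : X -> R[i]) : X -> R[i] :=
  fun x => (Liter n w (g \* real_fun (fiber w)) x /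
            real_fun (fiber (shift n%:Z w)) x)%R.

Definition decay (lambda eps' : R) (D Dt : paths Y -> R) :=
  [/\ tempered P D, tempered P Dt &
   {ae P, forall w, forall n : nat,
     [/\ opnorm_le m v (fun g => Liter n w (Pi_op w g))
           (D w * expR (- lambda * n%:R))%R,
         opnorm_le m v (fun g => Liter n w (g \- Pi_op w g)%R)
           (D w * expR (eps' * n%:R))%R,
         opnorm_le m v (fun g => nLiter n w (Pit_op w g))
           (Dt w * expR (- lambda * n%:R))%R &
         opnorm_le m v (fun g => nLiter n w (g \- Pit_op w g)%R) (Dt w)]}].

End density.

Definition slow_variation (eps : R) (D Dt N H K : paths Y -> R) :=
  let Kt w := Num.max (Num.max (D w) (Dt w)) (Num.max (N w) (H w)) in
  [/\ tempered P K, (forall w, 1 < K w)%R,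
      {ae P, forall w, ((K w)^-1 <= Kt w <= K w)%R} &
      {ae P, forall w, forall n : int,
        (K w * expR (- eps * `|n|%:~R) <= K (shift n w)
           <= K w * expR (eps * `|n|%:~R))%R}].

Definition ess_sup_K (K : paths Y -> R) (phi : paths Y * X -> R) : \bar R :=
  ess_sup P (fun w => (K w)%:E * bvnorm m v (real_fun (fun x => phi (w, x)))).

End cocycle.

(* min_(a in A, c in B) |a - c| for nonempty A and B: distances in 'I_n are
   smaller than n, so the default value n is never attained. *)
Definition setdist (n : nat) (A B : {set 'I_n}) : nat :=
  \big[minn/n]_(a in A) \big[minn/n]_(c in B) `|(a : nat)%:Z - (c : nat)%:Z|%N.

(* Main.v *)
(** By stationarity of [mu] two blocks of times are written as lists of gaps,
    and correlations are estimated in two stages.  On the fibre over [w], the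
    weights of the first block are absorbed one by one into the density, which
    stays bounded in BV because [K(w) * bvnorm phi_w] is bounded; the
    exponential decay of [L^n] on mean-zero functions then makes the fibre
    expectation of the product nearly the product of the fibre expectations.
    On the base, starting from [m] instead of [h_w] at the time [q = [b/3] + 1]
    steps earlier replaces each fibre expectation, up to
    [exp (- (lambda - eps) * q)], by a function of finitely many coordinates,
    and the mixing of [xi] decorrelates these across the gap.  For interleaved
    families, split off the maximal final segment of the union of the [A_j]
    lying in a single [A_j] and induct on the number of points. *)

From HB Require Import structures.
From mathcomp Require Import all_boot all_order all_algebra.
From mathcomp Require Import all_classical all_reals all_analysis.
From mathcomp Require Import measurable_realfun ess_sup_inf complex.
From mathcomp Require Import zify ring lra.
Require Import Defs.

Set Implicit Arguments.
Unset Strict Implicit.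
Unset Printing Implicit Defensive.

Import Order.TTheory GRing.Theory Num.Theory.
Import numFieldNormedType.Exports.

Local Open Scope classical_set_scope.
Local Open Scope ring_scope.

Local Notation Re := complex.Re.
Local Notation Im := complex.Im.
Local Notation normc := Normc.normc.

(** The random variable [K] need not be bounded, so no decay estimate is uniform over the fibres by
    itself; only the product [K(w) * bvnorm phi_w] is controlled. Each use of decay over [n] steps
    is therefore paired with the factor of [phi] at the arrival time: the loss [K(w)] against the
    gain [1 / K(shift n w)] leaves at most [exp (eps * n)], which lowers the rate from [lambda] to
    [lambda - eps]. Mixing cannot be applied to the fibre expectations directly, because [h_w] may
    depend on the whole past of [w]; with initial law [m], only coordinates from the starting time
    on are read. The gap between two blocks must then hold both the relaxation from [m] and the
    steps needed for mixing. *)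

Section bounded_integrals.
Context {d : measure_display} {T : measurableType d} {R : realType}.
Variable p : probability T R.
Implicit Types f g : T -> R.

Lemma ae_bound_ge0 f (M : R) : {ae p, forall x, `|f x| <= M} -> 0 <= M.
Proof.
move=> fM; have ae_proper := ae_properfilter_algebraOfSetsType (mu := p).
have [|x] := @filter_ex _ _ (ae_proper _) _ fM; last exact: le_trans.
have p0 : (0 < p [set: T])%E by rewrite (probability_setT p) lte01.
exact: p0.
Qed.

Lemma integral_cst_prob (c : \bar R) : (\int[p]_x (cst c) x = c)%E.
Proof.
by rewrite integral_cst// -[RHS]mule1; congr (_ * _)%E; exact: probability_setT.
Qed.

Lemma Rintegral_cst_prob (c : R) : \int[p]_x c = c.
Proof. by rewrite /Rintegral integral_cst_prob. Qed.

Lemma bounded_integrable f (M : R) : measurable_fun setT f ->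
  (forall x, `|f x| <= M) -> p.-integrable setT (EFin \o f).
Proof.
move=> mf fM; apply: measurable_bounded_integrable => //.
- by rewrite -ge0_fin_numE// fin_num_measure.
- exists M; split; first exact: num_real.
  by move=> y My x _; apply: le_trans (fM x) (ltW My).
Qed.

Lemma integrableM_bounded f g (M : R) : p.-integrable setT (EFin \o f) ->
  measurable_fun setT g -> (forall x, `|g x| <= M) ->
  p.-integrable setT (EFin \o (f \* g)).
Proof.
move=> fi mg gM.
have -> : EFin \o (f \* g) = ((EFin \o f) \* (EFin \o g))%E.
  by apply/funext => x.
apply: integrableMl => //; exists M; split; first exact: num_real.
by move=> y My x _; apply: le_trans (gM x) (ltW My).
Qed.

Lemma le_norm_Rintegral_ae f (c : R) : measurable_fun setT f ->
  {ae p, forall x, `|f x| <= c} -> `|\int[p]_x f x| <= c.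
Proof.
move=> mf fc.
have h : (`| \int[p]_x (f x)%:E | <= c%:E)%E.
  apply: (le_trans (le_abse_integral p measurableT _)).
    exact/measurable_EFinP.
  have -> : c%:E = (\int[p]_x (cst c%:E) x)%E.
    by rewrite integral_cst_prob.
  have c0 := ae_bound_ge0 fc.
  apply: ae_ge0_le_integral => //.
  - apply: measurableT_comp => //; exact/measurable_EFinP.
  - by apply: filterS fc => x xc _; rewrite abse_EFin lee_fin.
have fin : (\int[p]_x (f x)%:E)%E \is a fin_num.
  by rewrite fin_num_abs (le_lt_trans h)// ltry.
by move: h; rewrite /Rintegral -{1}(fineK fin) abse_EFin lee_fin.
Qed.

Lemma ae_bounded_integrable f (M : R) : measurable_fun setT f ->
  {ae p, forall x, `|f x| <= M} -> p.-integrable setT (EFin \o f).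
Proof.
move=> mf fM; apply/integrableP; split; first exact/measurable_EFinP.
apply: (@le_lt_trans _ _ (\int[p]_x (cst M%:E) x)%E).
  apply: ae_ge0_le_integral => //.
  - by apply: measurableT_comp => //; exact/measurable_EFinP.
  - by move=> x _; rewrite lee_fin (ae_bound_ge0 fM).
  - by apply: filterS fM => x xM _; rewrite lee_fin.
by rewrite integral_cst_prob ltry.
Qed.

Lemma le_norm_Rintegral f (c : R) : measurable_fun setT f ->
  (forall x, `|f x| <= c) -> `|\int[p]_x f x| <= c.
Proof. by move=> mf fc; apply: le_norm_Rintegral_ae => //; apply: aeW. Qed.

End bounded_integrals.

(** * Covariance inequality under strong mixing *)

Section covariance.
Context {d : measure_display} {T : measurableType d} {R : realType}.
Variable p : probability T R.
Implicit Types f g : T -> R.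

Definition cov f g : R :=
  \int[p]_x (f x * g x) - (\int[p]_x f x) * (\int[p]_x g x).

Lemma covC f g : cov f g = cov g f.
Proof. by rewrite /cov mulrC; under eq_Rintegral do rewrite mulrC. Qed.

(** A discrete layer-cake formula: counting the integers below [y] recovers [y] up to 1. With
    [y = N * f x] it approximates [f] within [1 / N] by an average of superlevel indicators. The
    second clause feeds the induction when [y] exceeds [N]. *)
Lemma sum_lt_nat (N : nat) (y : R) : 0 <= y ->
  (y <= N%:R -> y <= \sum_(k < N) (k%:R < y)%R%:R <= y + 1) /\
  (N%:R <= y -> \sum_(k < N) (k%:R < y)%R%:R = N%:R :> R).
Proof.
move=> y0; elim: N => [|N [IH1 IH2]].
  rewrite big_ord0; split=> // yN.
  by apply/andP; split=> //; rewrite addr_ge0.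
rewrite big_ord_recr/=; have [yN|yN] := leP y N%:R.
  rewrite addr0; split=> [_|Ny]; first exact: IH1.
  by have := le_trans Ny yN; rewrite ler_nat ltnn.
rewrite (IH2 (ltW yN)) -natr1; split=> [->/=|//].
by rewrite lerD2r ltW.
Qed.

Lemma covZl (a c : R) f g (Mf Mg : R) : measurable_fun setT f ->
  (forall x, `|f x| <= Mf) -> measurable_fun setT g ->
  (forall x, `|g x| <= Mg) -> cov (fun x => a * f x + c) g = a * cov f g.
Proof.
move=> mf fM mg gM; rewrite /cov.
have fi := bounded_integrable p mf fM; have gi := bounded_integrable p mg gM.
have fgi : p.-integrable setT (EFin \o (fun x => f x * g x)).
  exact: (@integrableM_bounded _ _ _ p f g Mg).
have afi : p.-integrable setT (EFin \o (fun x => a * f x)) by apply: (integrableZl measurableT a fi).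
have agi : p.-integrable setT (EFin \o (fun x => a * (f x * g x))).
  exact: (integrableZl measurableT a fgi).
have cgi : p.-integrable setT (EFin \o (fun x => c * g x)) by apply: (integrableZl measurableT c gi).
have ci : p.-integrable setT (EFin \o (fun=> c)).
  by apply: finite_measure_integrable_cst.
under eq_Rintegral do rewrite mulrDl -mulrA.
rewrite !RintegralD// !RintegralZl// Rintegral_cst_prob.
by ring.
Qed.

Lemma covDl f1 f2 g (M1 M2 Mg : R) : measurable_fun setT f1 ->
  (forall x, `|f1 x| <= M1) -> measurable_fun setT f2 ->
  (forall x, `|f2 x| <= M2) -> measurable_fun setT g ->
  (forall x, `|g x| <= Mg) ->
  cov (fun x => f1 x + f2 x) g = cov f1 g + cov f2 g.
Proof.
move=> mf1 fM1 mf2 fM2 mg gM; rewrite /cov.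
have f1i := bounded_integrable p mf1 fM1.
have f2i := bounded_integrable p mf2 fM2.
have f1gi : p.-integrable setT (EFin \o (fun x => f1 x * g x)).
  exact: (@integrableM_bounded _ _ _ p f1 g Mg).
have f2gi : p.-integrable setT (EFin \o (fun x => f2 x * g x)).
  exact: (@integrableM_bounded _ _ _ p f2 g Mg).
under eq_Rintegral do rewrite mulrDl.
by rewrite !RintegralD//; ring.
Qed.

Lemma norm_cov_le f g (Mf Mg : R) : measurable_fun setT f ->
  (forall x, `|f x| <= Mf) -> measurable_fun setT g ->
  (forall x, `|g x| <= Mg) -> `|cov f g| <= 2 * (Mf * Mg).
Proof.
move=> mf fM mg gM; rewrite /cov; apply: (le_trans (ler_normB _ _)).
rewrite mulr_natl mulr2n lerD//.
  apply: le_norm_Rintegral => [|x]; first exact: measurable_funM.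
  by rewrite normrM ler_pM.
by rewrite normrM ler_pM// le_norm_Rintegral.
Qed.

Definition superlevel f (s : R) : T -> R := fun x => (s < f x)%R%:R.

Lemma measurable_superlevel f s : measurable_fun setT f ->
  measurable_fun setT (superlevel f s).
Proof.
move=> mf; have -> : superlevel f s = \1_[set x | s < f x].
  apply/funext => x; rewrite /superlevel indicE; congr (nat_of_bool _)%:R.
  by apply/idP/idP; rewrite inE.
apply: measurable_indic.
have -> : [set x | s < f x] = f @^-1` `]s, +oo[.
  by apply/seteqP; split => x /=; rewrite in_itv/= andbT.
by rewrite -[X in measurable X]setTI; apply: mf => //; exact: measurable_itv.
Qed.

Lemma norm_superlevel f s x : `|superlevel f s x| <= 1.
Proof. by rewrite /superlevel; case: ltP; rewrite ?normr1 ?normr0. Qed.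

(** Covariance is linear in [f], so an average of [N] superlevel indicators inherits their bound
    [b]. The remainder [D] is at most [1 / N] and contributes at most [2 * Mg / N], which the choice
    of [N] makes at most [e]. *)
Lemma cov_superlevel_unit f g (Mg b : R) : measurable_fun setT f ->
  (forall x, 0 <= f x <= 1) -> measurable_fun setT g ->
  (forall x, `|g x| <= Mg) -> (forall s, `|cov (superlevel f s) g| <= b) ->
  `|cov f g| <= b.
Proof.
move=> mf f01 mg gM hb.
have f1 x : `|f x| <= 1 by have /andP[? ?] := f01 x; rewrite ger0_norm.
have Mg0 : 0 <= Mg by apply: (@ae_bound_ge0 _ _ _ p _ _ (aeW p gM)).
apply/ler_addgt0Pr => e e0.
pose N := (Num.truncn (2 * Mg / e)).+1.
have N0 : 0 < N%:R :> R by rewrite ltr0n.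
pose s k x : R := superlevel f (k%:R / N%:R) x.
have ms k : measurable_fun setT (s k) by exact: measurable_superlevel.
pose F (n : nat) x : R := \sum_(k < n) s k x.
have mF n : measurable_fun setT (F n) by exact: measurable_sum.
have FM n x : `|F n x| <= n%:R.
  apply: (le_trans (ler_norm_sum _ _ _)).
  rewrite -[X in _ <= X%:R]card_ord -sum1_card natr_sum.
  by apply: ler_sum => k _; exact: norm_superlevel.
have covF n : `|cov (F n) g| <= n%:R * b.
  elim: n => [|n IH].
    rewrite /cov /F.
    under eq_Rintegral do rewrite big_ord0 mul0r.
    under [X in _ - X * _]eq_Rintegral do rewrite big_ord0.
    by rewrite !Rintegral_cst// !mul0r subrr normr0.
  have -> : F n.+1 = fun x => F n x + s n x.
    by apply/funext => x; rewrite /F big_ord_recr.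
  rewrite (covDl (mF n) (FM n) (ms n) (norm_superlevel _ _) mg gM).
  apply: (le_trans (ler_normD _ _)).
  by rewrite -natr1 mulrDl mul1r lerD// hb.
pose D x := f x + (- N%:R^-1 * F N x).
have mD : measurable_fun setT D.
  by apply: measurable_funD => //; exact: measurable_funM.
have DM x : `|D x| <= N%:R^-1.
  have y0 : 0 <= N%:R * f x by rewrite mulr_ge0//; case/andP: (f01 x).
  have [+ _] := sum_lt_nat N y0.
  have -> : \sum_(k < N) (k%:R < N%:R * f x)%R%:R = F N x.
    by apply: eq_bigr => k _; rewrite /s /superlevel ltr_pdivrMr// [f x * _]mulrC.
  have /andP[_ fx1] := f01 x.
  rewrite -[X in _ <= X -> _]mulr1 ler_pM2l// => /(_ fx1) /andP[a1 a2].
  have -> : D x = - N%:R^-1 * (F N x - N%:R * f x).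
    by rewrite /D mulrBr addrC; congr (_ + _); rewrite mulNr opprK mulKf// gt_eqF.
  rewrite mulNr normrN normrM [`|N%:R^-1|]gtr0_norm ?invr_gt0//.
  rewrite ler_piMr ?invr_ge0 ?ler0n//.
  by rewrite ger0_norm; lra.
have nF : measurable_fun setT (fun x => N%:R^-1 * F N x).
  exact: measurable_funM.
have nFM x : `|N%:R^-1 * F N x| <= 1.
  by rewrite normrM gtr0_norm ?invr_gt0// ler_pdivrMl// mulr1.
have -> : cov f g = cov D g + cov (fun x => N%:R^-1 * F N x) g.
  rewrite -(covDl mD DM nF nFM mg gM); congr (cov _ g).
  by apply/funext => x; rewrite /D; ring.
rewrite addrC; apply: (le_trans (ler_normD _ _)); apply: lerD.
  have -> : (fun x => N%:R^-1 * F N x) = (fun x => N%:R^-1 * F N x + 0).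
    by apply/funext => x; rewrite addr0.
  rewrite (covZl _ _ (mF N) (FM N) mg gM) normrM gtr0_norm ?invr_gt0//.
  by rewrite ler_pdivrMl.
apply: (le_trans (norm_cov_le mD DM mg gM)).
rewrite mulrCA ler_pdivrMl// mulrC -ler_pdivrMr//.
by rewrite [Mg * 2]mulrC; apply/ltW/truncnS_gt.
Qed.

(** Rescaling [[-Mf, Mf]] onto [[0, 1]] produces the factor [2 * Mf]; the translation leaves
    covariances alone and the superlevel sets are only relabelled. *)
Lemma cov_superlevel f g (Mf Mg b : R) : measurable_fun setT f ->
  (forall x, `|f x| <= Mf) -> measurable_fun setT g ->
  (forall x, `|g x| <= Mg) -> (forall s, `|cov (superlevel f s) g| <= b) ->
  `|cov f g| <= 2 * Mf * b.
Proof.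
move=> mf fM mg gM hb.
have Mf0 : 0 <= Mf by apply: (@ae_bound_ge0 _ _ _ p _ _ (aeW p fM)).
move: Mf0; rewrite le_eqVlt => /orP[/eqP Mf0|Mf0].
  have f0 x : `|f x| <= 0 by rewrite Mf0.
  have := norm_cov_le mf f0 mg gM.
  by rewrite -Mf0 mulr0 !mul0r mulr0.
pose u x := (f x + Mf) / (2 * Mf).
have M2 : 0 < 2 * Mf by rewrite mulr_gt0.
have mu : measurable_fun setT u.
  by apply: measurable_funM => //; exact: measurable_funD.
have u01 x : 0 <= u x <= 1.
  have := fM x; rewrite ler_norml => /andP[a1 a2].
  by rewrite /u ler_pdivlMr// ler_pdivrMr// mul0r mul1r; apply/andP; split; lra.
have u1 x : `|u x| <= 1 by have /andP[? ?] := u01 x; rewrite ger0_norm.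
have -> : f = fun x => (2 * Mf) * u x + (- Mf).
  by apply/funext => x; rewrite /u mulrC divfK ?gt_eqF// addrK.
rewrite (covZl _ _ mu u1 mg gM) normrM gtr0_norm// ler_pM2l//.
apply: (cov_superlevel_unit mu u01 mg gM) => s.
have -> : superlevel u s = superlevel f (s * (2 * Mf) - Mf); last exact: hb.
by apply/funext => x; rewrite /superlevel /u ltr_pdivlMr// ltrBlDr.
Qed.

(** The superlevel reduction is applied in [f] and then, by symmetry, in [g]. Each pass costs a
    factor 2, and the covariance of two events remains. *)
Lemma cov_le_mixing f g (Mf Mg a : R) : measurable_fun setT f ->
  (forall x, `|f x| <= Mf) -> measurable_fun setT g ->
  (forall x, `|g x| <= Mg) ->
  (forall s t, `|fine (p ([set x | s < f x] `&` [set x | t < g x])) -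
    fine (p [set x | s < f x]) * fine (p [set x | t < g x])| <= a) ->
  `|cov f g| <= 4 * Mf * Mg * a.
Proof.
move=> mf fM mg gM hst.
have -> : 4 * Mf * Mg * a = 2 * Mf * (2 * Mg * a) by ring.
apply: (cov_superlevel mf fM mg gM) => s.
rewrite covC; apply: (cov_superlevel mg gM (measurable_superlevel _ mf)
  (norm_superlevel _ _)) => t.
rewrite covC; have := hst s t; congr (`| _ | <= _).
have mS (k : T -> R) (v : R) : measurable_fun setT k -> measurable [set x | v < k x].
  move=> mk; have -> : [set x | v < k x] = k @^-1` `]v, +oo[.
    by apply/seteqP; split => x /=; rewrite in_itv/= andbT.
  by rewrite -[X in measurable X]setTI; apply: mk => //; exact: measurable_itv.
have E (A : set T) : measurable A -> fine (p A) = \int[p]_x \1_A x.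
  by move=> mA; rewrite /Rintegral integral_indic// setIT.
rewrite /cov !E//; [|exact: mS..|by apply: measurableI; exact: mS].
congr (_ - _ * _).
- apply: eq_Rintegral => x _; rewrite indicI /superlevel /= !indicE.
  by congr ((nat_of_bool _)%:R * (nat_of_bool _)%:R); apply/idP/idP; rewrite inE.
- apply: eq_Rintegral => x _; rewrite /superlevel /= !indicE.
  by congr (nat_of_bool _)%:R; apply/idP/idP; rewrite inE.
- apply: eq_Rintegral => x _; rewrite /superlevel /= !indicE.
  by congr (nat_of_bool _)%:R; apply/idP/idP; rewrite inE.
Qed.

End covariance.

(** * Transport of integrals and null sets by measure-preserving maps *)

Section measure_preserving.
Context {d1 d2 : measure_display} {T1 : measurableType d1}
  {T2 : measurableType d2} {R : realType}.
Variables (p1 : probability T1 R) (p2 : probability T2 R) (F : T1 -> T2).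
Hypothesis mF : measurable_fun setT F.
Hypothesis pF : forall A, measurable A -> p1 (F @^-1` A) = p2 A.

Lemma ae_preserving (Q : T2 -> Prop) :
  {ae p2, forall x, Q x} -> {ae p1, forall x, Q (F x)}.
Proof.
move=> [N [mN N0 QN]]; exists (F @^-1` N); split.
- by rewrite -[X in measurable X]setTI; exact: mF.
- by rewrite pF.
- by move=> x /= nQ; apply: QN.
Qed.

Lemma Rintegral_preserving (f : T2 -> R) (M : R) : measurable_fun setT f ->
  {ae p2, forall x, `|f x| <= M} -> \int[p1]_x f (F x) = \int[p2]_x f x.
Proof.
move=> mf fM; rewrite /Rintegral; congr fine.
have fG : p1.-integrable setT (EFin \o (f \o F)).
  apply: (@ae_bounded_integrable _ _ _ p1 _ M); last exact: ae_preserving fM.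
  exact: (measurableT_comp mf mF).
have := @integral_pushforward _ _ _ _ _ F mF p1 setT (EFin \o f) _ fG measurableT.
rewrite preimage_setT => <-; last exact/measurable_EFinP.
by apply: eq_measure_integral => A mA _; exact: pF.
Qed.

End measure_preserving.

(** * The shift on path space and the mixing coefficients of the process *)

Section paths.
Context {d : measure_display} {Y : measurableType d} {R : realType}.
Implicit Types (w : paths Y).

Lemma shift_shift a b w : shift a (shift b w) = shift (b + a) w.
Proof. by apply/funext => j; rewrite /shift -addrA [b + a]addrC. Qed.

Lemma shift0 w : shift 0 w = w.
Proof. by apply/funext => j; rewrite /shift addr0. Qed.

Lemma measurable_cylinder (j : int) (B : set Y) : measurable B ->
  measurable [set w : paths Y | B (w j)].
Proof. by move=> mB; apply: sub_sigma_algebra; exists j, B. Qed.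

Lemma measurable_to_paths d' (S : measurableType d') (F : S -> paths Y) :
  (forall j, measurable_fun setT (fun s => F s j)) -> measurable_fun setT F.
Proof.
move=> mF; refine (@measurability _ _ S (paths Y) _ F (@cylinders _ Y) erefl _).
move=> _ [_ [j [B mB ->]] <-]; exact: mF.
Qed.

Lemma measurable_coordinate (j : int) :
  measurable_fun setT (fun w : paths Y => w j).
Proof.
by move=> _ B mB; rewrite setTI; exact: measurable_cylinder.
Qed.

Lemma measurable_shift (n : int) :
  measurable_fun setT (shift n : paths Y -> paths Y).
Proof.
by apply: measurable_to_paths => j; exact: measurable_coordinate.
Qed.

Definition depends_on (A : Type) (J : set int) (f : paths Y -> A) :=
  forall w w', (forall j, J j -> w j = w' j) -> f w = f w'.

Section invariance.
Variable P : probability (paths Y) R.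
Hypothesis hinv : shift_invariant P.

Lemma shift_invariant_int (n : int) (A : set (paths Y)) : measurable A ->
  P (shift n @^-1` A) = P A.
Proof.
have pre a (B : set (paths Y)) : measurable B -> measurable (shift a @^-1` B).
  by move=> mB; rewrite -[X in measurable X]setTI; exact: measurable_shift.
have nat_inv (k : nat) B : measurable B -> P (shift k%:Z @^-1` B) = P B.
  elim: k B => [|k IH] B mB.
    by congr (P _); apply/seteqP; split => w /=; rewrite shift0.
  rewrite -(hinv mB) -(IH _ (pre 1 _ mB)); congr (P _).
  by apply/seteqP; split => w /=; rewrite shift_shift -PoszD addn1.
move=> mA; case: n => k; first exact: nat_inv.
rewrite -(nat_inv k.+1 _ (pre _ _ mA)); congr (P _).
by apply/seteqP; split => w /=; rewrite shift_shift NegzE subrr shift0.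
Qed.

Lemma Rintegral_shift (n : int) (f : paths Y -> R) (M : R) :
  measurable_fun setT f -> {ae P, forall w, `|f w| <= M} ->
  \int[P]_w f (shift n w) = \int[P]_w f w.
Proof.
apply: Rintegral_preserving; first exact: measurable_shift.
by move=> A mA; exact: shift_invariant_int.
Qed.

Lemma ae_shift (Q : paths Y -> Prop) :
  {ae P, forall w, Q w} -> {ae P, forall w, forall n, Q (shift n w)}.
Proof.
move=> hQ.
have : {ae P, forall w, forall k : nat, Q (shift k%:Z w) /\ Q (shift (- k%:Z) w)}.
  apply: ae_foralln => k.
  have H a : {ae P, forall w, Q (shift a w)}.
    apply: ae_preserving hQ; first exact: measurable_shift.
    by move=> A mA; exact: shift_invariant_int.
  by apply: filterS2 (H k%:Z) (H (- k%:Z)).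
by apply: filterS => w hw [k|k]; [case: (hw k)|case: (hw k.+1); rewrite NegzE].
Qed.

End invariance.

Section mixing.
Context {dS : measure_display} {S : measurableType dS}.
Variables (PP : probability S R) (xi : int -> S -> Y).
Hypothesis hxi : forall j, measurable_fun setT (xi j).
Variable P : probability (paths Y) R.
Hypothesis hP : is_law PP xi P.

Lemma sigma_gen_measurable (J : set int) : sigma_gen xi J `<=` measurable.
Proof.
apply: smallest_sub; first exact: sigma_algebra_measurable.
by move=> _ [j Jj [B mB <-]]; exact: hxi.
Qed.

(* Freezing the coordinates outside [J] leaves [A] unchanged, and only the
   coordinates in [J] enter the frozen path. *)
Lemma depends_on_sigma_gen (J : set int) (A : set (paths Y)) :
  measurable A -> depends_on J A ->
  sigma_gen xi J (process_path xi @^-1` A).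
Proof.
move=> mA dA.
have [[w0]|noY] := pselect (inhabited (paths Y)); last first.
  suff -> : process_path xi @^-1` A = set0.
    by have [h0 _ _] := smallest_sigma_algebra setT
      (\bigcup_(j in J) preimage_set_system setT (xi j) measurable).
  by apply/seteqP; split => s //= _; case: noY; constructor; exact: process_path s.
pose fr (w : paths Y) : paths Y := fun j => if `[< J j >] then w j else w0 j.
have -> : process_path xi @^-1` A = (fr \o process_path xi) @^-1` A.
  apply/seteqP; split => s /=; rewrite (dA _ (fr (process_path xi s)))// => j Jj;
  by rewrite /fr asboolT.
pose G := [set B : set (paths Y) |
  sigma_gen xi J ((fr \o process_path xi) @^-1` B)].
suff : (@measurable _ (paths Y)) `<=` G by apply.
have [s0 sC sU] := smallest_sigma_algebra setT
  (\bigcup_(j in J) preimage_set_system setT (xi j) measurable).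
apply: smallest_sub.
- split.
  + by rewrite /G/= preimage_set0.
  + by move=> B GB; rewrite /G/= setTD preimage_setC -setTD; exact: sC.
  + by move=> B GB; rewrite /G/= preimage_bigcup; exact: sU.
- move=> _ [j [B mB ->]]; rewrite /G/=.
  have [Jj|nJj] := pselect (J j).
    apply: sub_sigma_algebra; exists j => //; exists B => //.
    by rewrite setTI; apply/seteqP; split => s /=; rewrite /fr asboolT.
  have [Bw|nBw] := pselect (B (w0 j)).
    have -> : (fr \o process_path xi) @^-1` [set w : int -> Y | B (w j)] = setT.
      by apply/seteqP; split => s //= _; rewrite /fr asboolF.
    by rewrite -[setT]setD0; exact: sC.
  have -> : (fr \o process_path xi) @^-1` [set w : int -> Y | B (w j)] = set0 => //.
  by apply/seteqP; split => s //=; rewrite /fr asboolF.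
Qed.

(** The [sup] in [alpha_coef] dominates the elements of its set only once that set is known to be
    bounded above. *)
Lemma alpha_coef_has_ubound (J J' : set int) :
  has_ubound [set r : R | exists a b, [/\ sigma_gen xi J a, sigma_gen xi J' b &
    r = `|fine (PP (a `&` b)) - fine (PP a) * fine (PP b)|]].
Proof.
exists 1 => _ [a [b [/sigma_gen_measurable ma /sigma_gen_measurable mb ->]]].
have F A : measurable A -> 0 <= fine (PP A) <= 1.
  move=> mA; rewrite fine_ge0//= -lee_fin fineK ?probability_le1//.
  exact: fin_num_measure.
have /andP[h1 h2] := F _ ma; have /andP[h3 h4] := F _ mb.
have /andP[h5 h6] := F _ (measurableI _ _ ma mb).
have h7 : 0 <= fine (PP a) * fine (PP b) by rewrite mulr_ge0.
have h8 : fine (PP a) * fine (PP b) <= 1 by rewrite mulr_ile1.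
by rewrite ler_norml; apply/andP; split; lra.
Qed.

Lemma alpha_ge (k : nat) a b : sigma_gen xi [set j | j <= 0] a ->
  sigma_gen xi [set j | k%:Z <= j] b ->
  `|fine (PP (a `&` b)) - fine (PP a) * fine (PP b)| <= alpha PP xi k.
Proof.
move=> ha hb; apply: ub_le_sup; first exact: alpha_coef_has_ubound.
by exists a, b.
Qed.

Lemma alpha_ge0 (k : nat) : 0 <= alpha PP xi k.
Proof.
have [s0 _ _] := smallest_sigma_algebra setT
  (\bigcup_(j in [set j : int | j <= 0]) preimage_set_system setT (xi j) measurable).
have [t0 _ _] := smallest_sigma_algebra setT
  (\bigcup_(j in [set j : int | k%:Z <= j]) preimage_set_system setT (xi j) measurable).
by apply: le_trans (alpha_ge s0 t0); exact: normr_ge0.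
Qed.

Lemma gamma_ge0 (lambda eps b : R) : 0 <= gamma_ PP xi lambda eps b.
Proof. by rewrite /gamma_ addr_ge0 ?expR_ge0 ?alpha_ge0. Qed.

Lemma cov_le_alpha (k : nat) (f g : paths Y -> R) (Mf Mg : R) :
  measurable_fun setT f -> (forall w, `|f w| <= Mf) ->
  measurable_fun setT g -> (forall w, `|g w| <= Mg) ->
  depends_on [set j | j <= 0] f -> depends_on [set j | k%:Z <= j] g ->
  `|cov P f g| <= 4 * Mf * Mg * alpha PP xi k.
Proof.
move=> mf fM mg gM df dg; apply: cov_le_mixing => // s t.
have mS (u : paths Y -> R) (v : R) : measurable_fun setT u ->
    measurable [set x | v < u x].
  move=> mu; have -> : [set x | v < u x] = u @^-1` `]v, +oo[.
    by apply/seteqP; split => x /=; rewrite in_itv/= andbT.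
  by rewrite -[X in measurable X]setTI; apply: mu => //; exact: measurable_itv.
have dS' (J : set int) (u : paths Y -> R) (v : R) : depends_on J u ->
    depends_on J [set x | v < u x].
  by move=> du x y xy; rewrite /= (du x y).
rewrite !hP ?preimage_setI; [|exact: mS..|by apply: measurableI; exact: mS].
by apply: alpha_ge; apply: depends_on_sigma_gen; auto.
Qed.

End mixing.

End paths.

(** * Complex-valued functions: integrals, [L1] and [BV] norms *)

Section complex_numbers.
Context {R : realType}.
Implicit Types (z : R[i]) (a : R).

Lemma ReD z1 z2 : Re (z1 + z2) = Re z1 + Re z2.
Proof. by case: z1; case: z2. Qed.

Lemma ImD z1 z2 : Im (z1 + z2) = Im z1 + Im z2.
Proof. by case: z1; case: z2. Qed.

Lemma ReN z : Re (- z) = - Re z.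
Proof. by case: z. Qed.

Lemma ReMr z a : Re (z * real_complex R a) = Re z * a.
Proof. by case: z => x y /=; rewrite mulr0 subr0. Qed.

Lemma ImMr z a : Im (z * real_complex R a) = Im z * a.
Proof. by case: z => x y /=; rewrite mulr0 add0r. Qed.

Lemma ReM_real_fun d (T : measurableType d) (u : T -> R) x z :
  Re (z * real_fun u x) = Re z * u x.
Proof. exact: ReMr. Qed.

Lemma Re_le_normc z : `|Re z| <= normc z.
Proof.
case: z => x y /=; rewrite -sqrtr_sqr ler_sqrt; last first.
  by rewrite addr_ge0// sqr_ge0.
by rewrite lerDl sqr_ge0.
Qed.

Lemma Im_le_normc z : `|Im z| <= normc z.
Proof.
case: z => x y /=; rewrite -sqrtr_sqr ler_sqrt; last first.
  by rewrite addr_ge0// sqr_ge0.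
by rewrite lerDr sqr_ge0.
Qed.

Lemma normc_ge0 z : 0 <= normc z.
Proof. exact: le_trans (normr_ge0 _) (Re_le_normc z). Qed.

Lemma normc_le_ReIm z : normc z <= `|Re z| + `|Im z|.
Proof.
case: z => x y /=; rewrite -[X in _ <= X]ger0_norm; last first.
  by rewrite addr_ge0.
rewrite -sqrtr_sqr ler_wsqrtr// sqrrD !real_normK ?num_real//.
by rewrite -addrA lerD2l lerDr mulrn_wge0// mulr_ge0.
Qed.

Lemma normc_real a : normc (real_complex R a) = `|a|.
Proof. by rewrite /= expr0n/= addr0 sqrtr_sqr. Qed.

End complex_numbers.

Section complex_function_norms.
Context {d : measure_display} {X : measurableType d} {R : realType}.
Variable m : probability X R.
Implicit Types f g : X -> R[i].

Lemma measurable_normc f : cmeasurable f ->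
  measurable_fun setT (fun x => normc (f x)).
Proof.
move=> [mRe mIm].
have -> : (fun x => normc (f x)) =
    fun x => Num.sqrt (Re (f x) ^+ 2 + Im (f x) ^+ 2).
  by apply/funext => x; case: (f x).
apply: (measurableT_comp (continuous_measurable_fun (@sqrt_continuous R))).
by apply: measurable_funD; exact: measurable_funX.
Qed.

Lemma norm1E f : norm1 m f = (\int[m]_x (normc (f x))%:E)%E.
Proof.
rewrite /norm1 Lnorm1; apply: eq_integral => x _.
by rewrite /cabs abse_EFin ger0_norm// normc_ge0.
Qed.

Lemma norm1_ge0 f : (0 <= norm1 m f)%E.
Proof. exact: Lnorm_ge0. Qed.

Lemma normoo_ge0 f : (0 <= normoo m f)%E.
Proof. exact: Lnorm_ge0. Qed.

Lemma normoo_leP f (c : R) :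
  (normoo m f <= c%:E)%E <-> {ae m, forall x, normc (f x) <= c}.
Proof.
have m0 : (0 < m [set: X])%E by rewrite (probability_setT m) lte01.
rewrite /normoo unlock /=.
(* The [+oo] norm is defined by cases on the total mass, which is positive for a probability. *)
have -> : (if (0 < m [set: X])%E then ess_sup m (abse \o cabs f) else 0%E) =
    ess_sup m (abse \o cabs f) by rewrite ifT.
split => [/ess_supP|fc].
  by apply: filterS => x /=; rewrite lee_fin ger0_norm// normc_ge0.
apply/ess_supP; move: fc.
by apply: filterS => x /=; rewrite lee_fin ger0_norm// normc_ge0.
Qed.

Lemma L1_normc f : L1 m f -> m.-integrable setT (fun x => (normc (f x))%:E).
Proof.
move=> [mf]; rewrite norm1E => fi; apply/integrableP; split.
  by apply/measurable_EFinP; exact: measurable_normc.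
under eq_integral do rewrite abse_EFin ger0_norm ?normc_ge0//.
exact: fi.
Qed.

Lemma L1_Re f : L1 m f -> m.-integrable setT (EFin \o (fun x => Re (f x))).
Proof.
move=> f1; apply: (le_integrable measurableT) (L1_normc f1).
  by apply/measurable_EFinP; case: f1 => -[].
move=> x _ /=; rewrite lee_fin [leRHS]ger0_norm ?normc_ge0//.
exact: Re_le_normc.
Qed.

Lemma L1_Im f : L1 m f -> m.-integrable setT (EFin \o (fun x => Im (f x))).
Proof.
move=> f1; apply: (le_integrable measurableT) (L1_normc f1).
  by apply/measurable_EFinP; case: f1 => -[].
move=> x _ /=; rewrite lee_fin [leRHS]ger0_norm ?normc_ge0//.
exact: Im_le_normc.
Qed.

Lemma L1_le_integrable f (k : X -> R) : cmeasurable f ->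
  m.-integrable setT (EFin \o k) ->
  (forall x, normc (f x) <= k x) -> L1 m f.
Proof.
move=> mf ki fk; split=> //; rewrite norm1E.
move/integrableP : ki => [mk]; apply: le_lt_trans.
apply: ge0_le_integral => //.
- by move=> x _; rewrite lee_fin normc_ge0.
- by apply/measurable_EFinP; exact: measurable_normc.
- by apply: measurableT_comp.
by move=> x _ /=; rewrite lee_fin (le_trans (fk x))// ler_norm.
Qed.

Lemma L1D f g : L1 m f -> L1 m g -> L1 m (f \+ g).
Proof.
move=> f1 g1; apply: (@L1_le_integrable _ (fun x => normc (f x) + normc (g x))).
- case: f1 g1 => -[a b] _ [[a' b'] _]; split.
    have -> : (fun x => Re ((f \+ g) x)) = (fun x => Re (f x) + Re (g x)).
      by apply/funext => x; exact: ReD.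
    exact: measurable_funD.
  have -> : (fun x => Im ((f \+ g) x)) = (fun x => Im (f x) + Im (g x)).
    by apply/funext => x; exact: ImD.
  exact: measurable_funD.
- exact: (integrableD measurableT (L1_normc f1) (L1_normc g1)).
- by move=> x /=; exact: le_normcD.
Qed.

Lemma L1Z (c : R[i]) f : L1 m f -> L1 m (fun x => c * f x).
Proof.
move=> f1; apply: (@L1_le_integrable _ (fun x => normc c * normc (f x))).
- case: f1 => -[a b] _; split.
    have -> : (fun x => Re (c * f x)) = (fun x => Re c * Re (f x) - Im c * Im (f x)).
      by apply/funext => x; case: c; case: (f x).
    by apply: measurable_funB; exact: measurable_funM.
  have -> : (fun x => Im (c * f x)) = (fun x => Re c * Im (f x) + Im c * Re (f x)).
    by apply/funext => x; case: c; case: (f x).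
  by apply: measurable_funD; exact: measurable_funM.
- exact: (integrableZl measurableT (normc c) (L1_normc f1)).
- by move=> x; rewrite Normc.normcM.
Qed.

Lemma L1_mul_bounded f (u : X -> R) (M : R) : L1 m f ->
  measurable_fun setT u -> (forall x, `|u x| <= M) -> L1 m (real_fun u \* f).
Proof.
move=> f1 mu uM.
apply: (@L1_le_integrable _ (fun x => M * normc (f x))).
- case: f1 => -[a b] _; split.
    have -> : (fun x => Re ((real_fun u \* f) x)) = (fun x => Re (f x) * u x).
      by apply/funext => x; rewrite /= [_ * f x]mulrC ReMr.
    exact: measurable_funM.
  have -> : (fun x => Im ((real_fun u \* f) x)) = (fun x => Im (f x) * u x).
    by apply/funext => x; rewrite /= [_ * f x]mulrC ImMr.
  exact: measurable_funM.
- exact: (integrableZl measurableT M (L1_normc f1)).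
- move=> x; rewrite /= Normc.normcM normc_real ler_wpM2r ?normc_ge0//.
Qed.

Lemma Re_cint f : Re (cint m f) = \int[m]_x Re (f x).
Proof. by []. Qed.

(** The factor 2 comes from bounding the real and imaginary parts separately; it enters the constant
    6 of [transfer_step]. *)
Lemma normc_cint_le f (b : R) : L1 m f -> (norm1 m f <= b%:E)%E ->
  normc (cint m f) <= 2 * b.
Proof.
move=> f1 fb; apply: (le_trans (normc_le_ReIm _)); rewrite mulr_natl mulr2n.
have N (k : X -> R) : m.-integrable setT (EFin \o k) ->
    (forall x, `|k x| <= normc (f x)) -> `|\int[m]_x k x| <= b.
  move=> ki kf; apply: (le_trans (le_normr_Rintegral measurableT ki)).
  have -> : b = fine b%:E by [].
  apply: fine_le => //.
    by apply: integrable_fin_num => //; exact: integrable_norm.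
  apply: le_trans fb; rewrite norm1E; apply: ge0_le_integral => //.
  - by apply/measurable_EFinP/measurableT_comp => //; case/integrableP: ki => /measurable_EFinP.
  - by apply/measurable_EFinP; apply: measurable_normc; case: f1.
  - by move=> x _; rewrite lee_fin.
apply: lerD.
- by apply: N; [exact: L1_Re|move=> x; exact: Re_le_normc].
- by apply: N; [exact: L1_Im|move=> x; exact: Im_le_normc].
Qed.

Lemma cmeasurable_real_fun (u : X -> R) : measurable_fun setT u ->
  cmeasurable (real_fun u).
Proof. by move=> mu; split => //=; exact: measurable_cst. Qed.

Lemma Loo_bounded (u : X -> R) (M : R) : measurable_fun setT u ->
  (forall x, `|u x| <= M) -> Loo m (real_fun u).
Proof.
move=> mu uM; split; first exact: cmeasurable_real_fun.
apply: (@le_lt_trans _ _ M%:E); last exact: ltry.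
by apply/normoo_leP; apply: aeW => x; rewrite normc_real.
Qed.

Lemma L1_bounded (u : X -> R) (M : R) : measurable_fun setT u ->
  (forall x, `|u x| <= M) -> L1 m (real_fun u).
Proof.
move=> mu uM; apply: (@L1_le_integrable _ (fun=> M)).
- exact: cmeasurable_real_fun.
- exact: finite_measure_integrable_cst.
- by move=> x; rewrite normc_real.
Qed.

Section variation.
Variable v : (X -> R[i]) -> \bar R.
Hypothesis hv : is_variation m v.

Local Notation bvnorm := (bvnorm m v).

Lemma bvnorm_BV f : BV m v f -> bvnorm f = (norm1 m f + v f)%E.
Proof. by move=> fBV; rewrite /Defs.bvnorm asboolT. Qed.

Lemma bvnorm_ltyP f : (bvnorm f < +oo)%E -> BV m v f.
Proof. by rewrite /Defs.bvnorm; case: asboolP => //; rewrite ltxx. Qed.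

Lemma bvnorm_leP f (b : R) : (bvnorm f <= b%:E)%E -> BV m v f.
Proof. by move=> fb; apply: bvnorm_ltyP; rewrite (le_lt_trans fb)// ltry. Qed.

Lemma BV_v_ge0 f : BV m v f -> (0 <= v f)%E.
Proof. by case=> f1 _; exact: variation_ge0 hv _ f1. Qed.

Lemma bvnorm_ge0 f : (0 <= bvnorm f)%E.
Proof.
rewrite /Defs.bvnorm; case: asboolP => // fBV.
by rewrite adde_ge0 ?norm1_ge0 ?BV_v_ge0.
Qed.

Lemma norm1_le_bvnorm f : (norm1 m f <= bvnorm f)%E.
Proof.
rewrite /Defs.bvnorm; case: asboolP => [fBV|_]; last by rewrite leey.
by rewrite leeDl// BV_v_ge0.
Qed.

Lemma v_le_bvnorm f : (v f <= bvnorm f)%E.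
Proof.
rewrite /Defs.bvnorm; case: asboolP => [fBV|_]; last by rewrite leey.
by rewrite leeDr// norm1_ge0.
Qed.

Lemma norm1D f g : L1 m f -> L1 m g -> (norm1 m (f \+ g)%R <= norm1 m f + norm1 m g)%E.
Proof.
move=> f1 g1; rewrite !norm1E -ge0_integralD//; last 4 first.
- by move=> x _; rewrite lee_fin normc_ge0.
- by apply/measurable_EFinP; apply: measurable_normc; case: f1.
- by move=> x _; rewrite lee_fin normc_ge0.
- by apply/measurable_EFinP; apply: measurable_normc; case: g1.
apply: ge0_le_integral => //.
- by move=> x _; rewrite lee_fin normc_ge0.
- by apply/measurable_EFinP; apply: measurable_normc; case: (L1D f1 g1).
- apply: emeasurable_funD; apply/measurable_EFinP; apply: measurable_normc.
    by case: f1.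
  by case: g1.
- by move=> x _; rewrite -EFinD lee_fin; exact: le_normcD.
Qed.

Lemma norm1Z (c : R[i]) f : L1 m f ->
  norm1 m (fun x => c * f x) = ((normc c)%:E * norm1 m f)%E.
Proof.
move=> f1; rewrite !norm1E -ge0_integralZl//.
- by apply: eq_integral => x _; rewrite Normc.normcM EFinM.
- by apply/measurable_EFinP; apply: measurable_normc; case: f1.
- by move=> x _; rewrite lee_fin normc_ge0.
- by rewrite lee_fin normc_ge0.
Qed.

Lemma bvnormD f g : (bvnorm (f \+ g)%R <= bvnorm f + bvnorm g)%E.
Proof.
have [fy|/bvnorm_ltyP fBV] := leP +oo%E (bvnorm f).
  move: fy; rewrite leye_eq => /eqP ->; rewrite addye ?leey//.
  by rewrite gt_eqF// (lt_le_trans ltNy0) ?bvnorm_ge0.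
have [gy|/bvnorm_ltyP gBV] := leP +oo%E (bvnorm g).
  move: gy; rewrite leye_eq => /eqP ->; rewrite addey ?leey//.
  by rewrite gt_eqF// (lt_le_trans ltNy0) ?bvnorm_ge0.
have [f1 vf] := fBV; have [g1 vg] := gBV.
have vfg := variationD hv f1 g1.
have fgBV : BV m v (f \+ g).
  by split; [exact: L1D|rewrite (le_lt_trans vfg)// lte_add_pinfty].
rewrite !bvnorm_BV// addeACA; apply: leeD => //; exact: norm1D.
Qed.

Lemma bvnormZ_le (c : R[i]) f (b a : R) : (bvnorm f <= b%:E)%E ->
  normc c <= a -> (bvnorm (fun x => c * f x)%R <= (a * b)%:E)%E.
Proof.
move=> fb ca; have fBV := bvnorm_leP fb; have [f1 vf] := fBV.
have cfBV : BV m v (fun x => c * f x).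
  split; first exact: L1Z.
  rewrite (variationZ hv)// lte_mul_pinfty ?lee_fin ?normc_ge0//.
rewrite bvnorm_BV// norm1Z// (variationZ hv)//.
rewrite -ge0_muleDr ?norm1_ge0 ?BV_v_ge0// -bvnorm_BV// EFinM.
by apply: lee_pmul; rewrite ?lee_fin ?normc_ge0 ?bvnorm_ge0.
Qed.

(** [BV] is an algebra up to a constant: the product rule for [v] has two terms, and each sup norm
    in it costs a factor [C]. The pointwise bound [M] serves the integrability of the product. *)
Lemma bvnorm_mul_le (C : R) (u : X -> R) f (M b c : R) : 0 <= C ->
  (forall g, (normoo m g <= C%:E * bvnorm g)%E) ->
  measurable_fun setT u -> (forall x, `|u x| <= M) ->
  (bvnorm (real_fun u) <= b%:E)%E -> (bvnorm f <= c%:E)%E ->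
  (bvnorm (real_fun u \* f)%R <= (2 * C * b * c)%:E)%E.
Proof.
move=> C0 hC mu uM ub fc.
have uBV := bvnorm_leP ub; have fBV := bvnorm_leP fc.
have [u1 vu] := uBV; have [f1 vf] := fBV.
have uf1 := L1_mul_bounded f1 mu uM.
have b0 : 0 <= b by rewrite -lee_fin (le_trans (bvnorm_ge0 _) ub).
have c0 : 0 <= c by rewrite -lee_fin (le_trans (bvnorm_ge0 _) fc).
have uC : (normoo m (real_fun u) <= (C * b)%:E)%E.
  by apply: (le_trans (hC _)); rewrite EFinM lee_wpmul2l ?lee_fin.
have fC : (normoo m f <= (C * c)%:E)%E.
  by apply: (le_trans (hC _)); rewrite EFinM lee_wpmul2l ?lee_fin.
have n1 : (norm1 m (real_fun u \* f)%R <= (C * b)%:E * norm1 m f)%E.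
  rewrite !norm1E -ge0_integralZl//; last first.
  - by rewrite lee_fin mulr_ge0.
  - by move=> x _; rewrite lee_fin normc_ge0.
  - by apply/measurable_EFinP; apply: measurable_normc; case: f1.
  apply: ae_ge0_le_integral => //.
  - by move=> x _; rewrite lee_fin normc_ge0.
  - by apply/measurable_EFinP; apply: measurable_normc; case: uf1.
  - by move=> x _; rewrite mule_ge0// lee_fin ?normc_ge0 ?mulr_ge0.
  - apply: emeasurable_funM => //; apply/measurable_EFinP.
    by apply: measurable_normc; case: f1.
  move/normoo_leP : uC; apply: filterS => x ux _.
  by rewrite -EFinM lee_fin /= Normc.normcM ler_wpM2r ?normc_ge0.
have v1 := variationM hv u1 f1 uf1.
have bound : (norm1 m (real_fun u \* f)%R + v (real_fun u \* f)%R <=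
    (2 * C * b * c)%:E)%E.
  apply: (@le_trans _ _ ((C * b)%:E * bvnorm f + (C * c)%:E * b%:E)%E).
    rewrite bvnorm_BV// ge0_muleDr ?norm1_ge0 ?BV_v_ge0// -addeA.
    apply: leeD => //; apply: (le_trans v1); apply: leeD.
      by rewrite lee_wpmul2r// BV_v_ge0.
    apply: lee_pmul => //; [exact: normoo_ge0|exact: BV_v_ge0|].
    exact: le_trans (v_le_bvnorm _) ub.
  apply: (@le_trans _ _ ((C * b)%:E * c%:E + (C * c)%:E * b%:E)%E).
    by rewrite leeD2r// lee_wpmul2l// lee_fin mulr_ge0.
  by rewrite -!EFinM -EFinD lee_fin; lra.
rewrite bvnorm_BV//; split=> //.
apply: (@le_lt_trans _ _ (2 * C * b * c)%:E); last exact: ltry.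
by apply: le_trans bound; rewrite leeDr// norm1_ge0.
Qed.

Lemma bvnorm_ae_le f g (b : R) : cmeasurable g ->
  {ae m, forall x, f x = g x} -> (bvnorm f <= b%:E)%E -> (bvnorm g <= b%:E)%E.
Proof.
move=> mg fg fb; have fBV := bvnorm_leP fb; have [f1 vf] := fBV.
have nfg : norm1 m g = norm1 m f.
  rewrite !norm1E; apply: ae_eq_integral => //.
  - by apply/measurable_EFinP; exact: measurable_normc.
  - by apply/measurable_EFinP; apply: measurable_normc; case: f1.
  - by apply: filterS fg => x -> _.
have g1 : L1 m g by split=> //; rewrite nfg; case: f1.
have vfg := variation_ae hv f1 g1 fg.
have gBV : BV m v g by split=> //; rewrite -vfg.
by rewrite (bvnorm_BV gBV) nfg -vfg -(bvnorm_BV fBV).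
Qed.

Lemma bvnorm_cst1 : bvnorm (fun=> 1) = 1%E.
Proof.
have c1 : real_fun (fun=> 1 : R) = (fun=> 1 : R[i]) :> (X -> R[i]).
  by apply/funext => x.
have L11 : L1 m (fun=> 1).
  by rewrite -c1; apply: (@L1_bounded _ 1) => // x; rewrite normr1.
rewrite bvnorm_BV; last by split => //; rewrite (variation_cst1 hv) ltry.
rewrite (variation_cst1 hv) adde0 norm1E.
have -> : (fun x : X => (normc (1 : R[i]))%:E) = cst 1%E.
  by apply/funext => x; rewrite Normc.normc1.
exact: integral_cst_prob.
Qed.

End variation.
End complex_function_norms.

(** * Integration against the mixture measure through its density *)

Section change_of_density.
Context {d : measure_display} {T : measurableType d} {R : realType}.
Variables (Q p : probability T R) (h : T -> R).
Hypothesis hi : Q.-integrable setT (EFin \o h).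
Hypothesis ph : forall A, measurable A -> p A = (\int[Q]_(z in A) (h z)%:E)%E.

(** [h] is integrable but may be negative on a null set, so it is first identified almost everywhere
    with the Radon-Nikodym derivative of [p], both having the same integrals over measurable
    sets. *)
Lemma integral_density (f : T -> R) (M : R) : measurable_fun setT f ->
  (forall z, `|f z| <= M) ->
  (\int[p]_z (f z)%:E = \int[Q]_z (h z * f z)%:E)%E.
Proof.
move=> mf fM; have mfE : measurable_fun setT (EFin \o f) by exact/measurable_EFinP.
have mhE : measurable_fun setT (EFin \o h) by exact: measurable_int hi.
have dom : null_dominates Q p.
  apply/null_content_dominatesP => A mA A0; rewrite ph//.
  by apply: null_set_integral => //; exact: measurable_funS mhE.
have fi : p.-integrable setT (EFin \o f) by exact: bounded_integrable fM.
have hfi := integrableM_bounded hi mf fM.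
have mRN : measurable_fun setT (Radon_Nikodym (charge_of_finite_measure p) Q).
  by case/integrableP: (@Radon_Nikodym_integrable _ _ _ (charge_of_finite_measure p) Q dom).
rewrite -(Radon_Nikodym_change_of_variables dom measurableT fi).
apply: ae_eq_integral => //.
- exact: emeasurable_funM.
- exact: measurable_int hfi.
- have : ae_eq Q setT (EFin \o h) (Radon_Nikodym (charge_of_finite_measure p) Q).
    apply: integral_ae_eq => // A _ mA.
    by rewrite -Radon_Nikodym_integral// -ph.
  by apply: filterS => z /(_ I) /= <- _; rewrite -EFinM mulrC.
Qed.

End change_of_density.

Section disintegration.
Context {d1 d2 : measure_display} {T1 : measurableType d1}
  {T2 : measurableType d2} {R : realType}.
Variables (P : probability T1 R) (m : probability T2 R).

Lemma measurable_Rintegral_fiber (f : T1 * T2 -> R) :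
  (P \x m)%E.-integrable setT (EFin \o f) ->
  measurable_fun setT (fun w => \int[m]_x f (w, x)).
Proof.
move=> fi; have mF := measurable_fubini_F fi.
exact: (measurableT_comp (fine_measurable measurableT) mF).
Qed.

Variables (h : T1 * T2 -> R) (mu : probability (T1 * T2)%type R).
Hypothesis mh : measurable_fun setT h.
Hypothesis hint : {ae P, forall w, (\int[m]_x `|(h (w, x))%:E| = 1)%E}.
Hypothesis hmu : forall A, measurable A ->
  mu A = (\int[P]_w \int[m]_(x in xsection A w) (h (w, x))%:E)%E.

Let mhE : measurable_fun setT (EFin \o h).
Proof. exact/measurable_EFinP. Qed.

Lemma density_integrable_prod : (P \x m)%E.-integrable setT (EFin \o h).
Proof.
apply/(integrable12ltyP P m mhE).
have -> : (\int[P]_w \int[m]_x `|(EFin \o h) (w, x)| = \int[P]_w (cst 1 w))%E.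
  apply: ae_eq_integral => //.
  - have ma : measurable_fun setT (abse \o (EFin \o h)).
      exact: (measurableT_comp _ mhE).
    exact: (@measurable_fun_fubini_tonelli_F _ _ _ _ _ m _ ma (fun z => abse_ge0 _)).
  - by apply: filterS hint => w hw _.
by rewrite integral_cst_prob ltry.
Qed.

Lemma mixture_density A : measurable A ->
  mu A = (\int[P \x m]_(z in A) (h z)%:E)%E.
Proof.
move=> mA; rewrite hmu// [RHS]integral_mkcond -integral12_prod_meas1; last first.
  apply/(integrable_mkcond _ mA).
  exact: (integrableS measurableT mA (@subsetT _ _) density_integrable_prod).
apply: eq_integral => w _; rewrite integral_mkcond /fubini_F.
apply: eq_integral => x _; rewrite /patch/=.
by rewrite mem_xsection.
Qed.

(** [mu] has density [h] with respect to [P \x m], so this is a change of density followed by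
    Fubini. *)
Lemma mixture_integral (f : T1 * T2 -> R) (M : R) : measurable_fun setT f ->
  (forall z, `|f z| <= M) ->
  \int[mu]_z f z = \int[P]_w \int[m]_x (h (w, x) * f (w, x)).
Proof.
move=> mf fM.
have hfi : (P \x m)%E.-integrable setT (EFin \o (h \* f)).
  exact: (integrableM_bounded density_integrable_prod mf fM).
rewrite /Rintegral (integral_density density_integrable_prod mixture_density mf fM).
rewrite -(integral12_prod_meas1 hfi); congr fine.
have /ae_integrable1 := hfi; move=> hfi1.
apply: ae_eq_integral => //.
- exact: measurable_fubini_F hfi.
- by apply/measurable_EFinP; exact: measurable_Rintegral_fiber hfi.
- apply: filterS hfi1 => w iw _; rewrite /fubini_F /Rintegral fineK//.
  by apply: integrable_fin_num.
Qed.

End disintegration.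

(** * Products along gap sequences and bookkeeping of constants *)

Section gap_products.
Context {Z : Type} {R : realType}.
Variables (phi : Z -> R) (tau : Z -> Z).

(* [gapprod [:: d1; ...; dk] z] is the product of [phi (tau^(d1 + ... + di) z)]
   over [1 <= i <= k]. *)
Fixpoint gapprod (l : seq nat) (z : Z) : R :=
  if l is d :: l' then phi (iter d tau z) * gapprod l' (iter d tau z) else 1.

(** A block of [size l + 1] times beginning at 0. Its first factor stands apart because it is
    absorbed into the starting density, while [gapprod] is treated by induction. *)
Definition obs (l : seq nat) (z : Z) : R := phi z * gapprod l z.

Lemma norm_gapprod (B : R) l z : (forall y, `|phi y| <= B) ->
  `|gapprod l z| <= B ^+ size l.
Proof.
move=> hB; elim: l z => [|k l IH] z /=; first by rewrite normr1.
by rewrite normrM exprS ler_pM.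
Qed.

Lemma norm_obs (B : R) l z : (forall y, `|phi y| <= B) ->
  `|obs l z| <= B ^+ (size l).+1.
Proof. by move=> hB; rewrite normrM exprS ler_pM// norm_gapprod. Qed.

End gap_products.

Lemma measurable_iter d (T : measurableType d) (f : T -> T) n :
  measurable_fun setT f -> measurable_fun setT (iter n f).
Proof.
move=> mf; elim: n => [|n IH]; first exact: measurable_id.
exact: (measurableT_comp mf IH).
Qed.

Lemma measurable_gapprod d (T : measurableType d) (R : realType) (phi : T -> R)
  (tau : T -> T) l : measurable_fun setT phi -> measurable_fun setT tau ->
  measurable_fun setT (gapprod phi tau l).
Proof.
move=> mp mt; elim: l => [|k l IH] /=; first exact: measurable_cst.
have mk := measurable_iter k mt.
apply: measurable_funM; first exact: (measurableT_comp mp mk).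
exact: (measurableT_comp IH mk).
Qed.

(** The common shape of the error terms in [gap_decorrelation]: one power for each block and two
    exceptional factors, in total one factor per point. *)
Lemma ler_expM4 (R : realType) (M p a c q : R) (s1 s2 : nat) :
  0 <= p <= M -> 0 <= a <= M -> 0 <= c <= M -> 0 <= q <= M ->
  p ^+ s1 * (a * (c * q ^+ s2)) <= M ^+ (s1 + s2).+2.
Proof.
move=> /andP[p0 pM] /andP[a0 aM] /andP[c0 cM] /andP[q0 qM].
have M0 := le_trans p0 pM.
have -> : M ^+ (s1 + s2).+2 = M ^+ s1 * (M * (M * M ^+ s2)).
  by rewrite -!addnS exprD !exprS.
have pX : p ^+ s1 <= M ^+ s1 by apply: lerXn2r.
have qX : q ^+ s2 <= M ^+ s2 by apply: lerXn2r.
have q1 : 0 <= q ^+ s2 by exact: exprn_ge0.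
have c1 : 0 <= c * q ^+ s2 by exact: mulr_ge0.
have a1 : 0 <= a * (c * q ^+ s2) by exact: mulr_ge0.
have p1 : 0 <= p ^+ s1 by exact: exprn_ge0.
by apply: ler_pM => //; apply: ler_pM => //; apply: ler_pM.
Qed.

(** Origin of the constant 5: one fibre error and four perturbation errors multiply [e], while the
    four mixing terms that multiply [a] are rounded up to five. *)
Lemma combine_errors (R : realType) (x y z p1 p2 t W e a : R) :
  x <= W * e -> y <= z + 2 * (p1 + p2) -> z <= t -> t <= 4 * W * a ->
  p1 <= W * e -> p2 <= W * e -> 0 <= W * a -> x + y <= 5 * W * (e + a).
Proof. by move=> *; rewrite mulrDr; lra. Qed.

(** Room inside an integer gap [d] for [k + 1] steps of relaxation and [k] steps of mixing, where [k
    = [b/3]]. If [k >= 1], then [2 * k + 1 <= 3 * k <= d]; if [k = 0], then [d >= 1] follows from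
    [b > 0]. *)
Lemma truncn_third (R : realType) (b : R) (d : nat) : 0 < b -> b <= d%:R ->
  (Num.truncn (b / 3%:R) + (Num.truncn (b / 3%:R)).+1 <= d)%N.
Proof.
move=> b0 bd; set k := Num.truncn _.
have kb : k%:R <= b / 3 by have /andP[] := truncn_itv (divr_ge0 (ltW b0) (ler0n R 3)).
have d0 : (0 < d)%N by rewrite -(ltr_nat R); apply: lt_le_trans bd.
have k3 : (k * 3 <= d)%N.
  by rewrite -(ler_nat R) natrM; apply: le_trans bd; rewrite -ler_pdivlMr.
lia.
Qed.

(** * Decay of correlations on a single fibre *)

Section cocycle.
Context {dX dY : measure_display} {X : measurableType dX}
  {Y : measurableType dY} {R : realType}.
Variables (m : probability X R) (v : (X -> R[i]) -> \bar R) (C : R).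
Hypothesis hv : is_variation m v.
Hypothesis hC : forall g : X -> R[i], (normoo m g <= C%:E * bvnorm m v g)%E.
Variables (T : paths Y -> X -> X) (L : paths Y -> (X -> R[i]) -> X -> R[i]).
Hypothesis hTns : forall w, nonsingular m (T w).
Hypothesis hL : forall w, is_transfer m (T w) (L w).
Variables (h : paths Y * X -> R) (K : paths Y -> R).
Variables (lambda eps rho0 B : R).
Hypothesis hle : eps < lambda.
Variable phi : paths Y * X -> R.
Hypothesis mphi : measurable_fun setT phi.
Hypothesis phiB : forall z, `|phi z| <= B.
Hypothesis mh : measurable_fun setT h.
Hypothesis K1 : forall w, 1 < K w.
Hypothesis rho0_ge0 : 0 <= rho0.

Local Notation bvnorm := (bvnorm m v).
Local Notation tau := (skew_map T).

(** Tested on the constant function 1, whose [BV] norm is 1. *)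
Lemma normoo_const_ge1 : 1 <= C.
Proof.
have c1 : real_fun (fun=> 1 : R) = (fun=> 1 : R[i]) :> (X -> R[i]).
  by apply/funext => x.
have := hC (fun=> 1); rewrite bvnorm_cst1// mule1 => /normoo_leP hc.
rewrite -subr_ge0; apply: (@ae_bound_ge0 _ _ _ m (fun=> 0)).
by apply: filterS hc => x; rewrite Normc.normc1 normr0 subr_ge0.
Qed.

Let C0 : 0 <= C. Proof. exact: le_trans ler01 normoo_const_ge1. Qed.

Let K0 w : 0 < K w. Proof. exact: lt_trans ltr01 (K1 w). Qed.

Lemma iter_skew n w x :
  iter n tau (w, x) = (shift n%:Z w, Titer T n w x).
Proof.
elim: n => [|n IH]; first by rewrite shift0.
by rewrite iterS IH /skew_map/= shift_shift -PoszD addn1.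
Qed.

Lemma measurable_Titer n w : measurable_fun setT (Titer T n w).
Proof.
elim: n => [|n IH]; first exact: measurable_id.
exact: (measurableT_comp (hTns (shift n%:Z w)).1 IH).
Qed.

Lemma Liter_dual n w f : L1 m f -> L1 m (Liter L n w f) /\
  forall (u : X -> R) (M : R), measurable_fun setT u -> (forall x, `|u x| <= M) ->
    \int[m]_x (Re (Liter L n w f x) * u x) =
    \int[m]_x (Re (f x) * u (Titer T n w x)).
Proof.
move=> f1; elim: n => [|n [IH1 IH2]]; first by [].
have [LL1 dual] := hL (shift n%:Z w) IH1.
split=> [//|u M mu uM] /=.
have := dual _ (Loo_bounded m mu uM) => /(congr1 (@complex.Re R)).
rewrite !Re_cint.
under eq_Rintegral do rewrite /= ReM_real_fun.
move=> ->.
under eq_Rintegral do rewrite /= ReM_real_fun.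
apply: (IH2 (u \o T (shift n%:Z w)) M); last by move=> x; exact: uM.
exact: (measurableT_comp mu (hTns _).1).
Qed.

(** The almost sure hypotheses at one fibre, gathered so that the following estimates are pointwise
    in [w]. The constant [D] of the decay is already absorbed into [K], and [phi] is small exactly
    where [K] is large. *)
Record fiber_good (w : paths Y) : Prop := FiberGood {
  fiber_decay : forall (n : nat) g b, (bvnorm g <= b%:E)%E ->
    (bvnorm (Liter L n w (Pi_op m h w g)) <=
      (K w * expR (- lambda * n%:R) * b)%:E)%E ;
  fiber_density : (bvnorm (real_fun (fiber h w)) <= (K w)%:E)%E ;
  fiber_density_ge0 : {ae m, forall x, 0 <= fiber h w x} ;
  fiber_density_int : \int[m]_x fiber h w x = 1 ;
  fiber_equivariant : {ae m, forall x,
    L w (real_fun (fiber h w)) x = real_fun (fiber h (shift 1 w)) x} ;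
  fiber_K : forall n : nat, K w <= K (shift n%:Z w) * expR (eps * n%:R) ;
  fiber_phi : (bvnorm (real_fun (fun x => phi (w, x))) <= (rho0 / K w)%:E)%E }.

(** Negative times are included because the restart from [m] takes place in the past of [w]. *)
Definition orbit_good (w : paths Y) := forall n : int, fiber_good (shift n w).

Lemma orbit_good_shift n w : orbit_good w -> orbit_good (shift n w).
Proof. by move=> gw k; rewrite shift_shift. Qed.

Lemma orbit_good_fiber w : orbit_good w -> fiber_good w.
Proof. by move=> /(_ 0); rewrite shift0. Qed.

Lemma measurable_fiber (u : paths Y * X -> R) w : measurable_fun setT u ->
  measurable_fun setT (fun x => u (w, x)).
Proof. by move=> mu; exact: (measurableT_comp mu (pair1_measurable w)). Qed.

Lemma density_L1 w : fiber_good w -> L1 m (real_fun (fiber h w)).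
Proof. by case=> _ /bvnorm_leP[]. Qed.

Lemma density_integrable w : fiber_good w ->
  m.-integrable setT (EFin \o fiber h w).
Proof. by move=> gw; have := L1_Re (density_L1 gw). Qed.

Lemma norm_density_integral w (u : X -> R) (M : R) : fiber_good w ->
  measurable_fun setT u -> (forall x, `|u x| <= M) ->
  `|\int[m]_x (fiber h w x * u x)| <= M.
Proof.
move=> gw mu uM; have hi := density_integrable gw.
have hui := integrableM_bounded hi mu uM.
apply: (le_trans (le_normr_Rintegral measurableT hui)).
have -> : M = \int[m]_x (M * fiber h w x).
  by rewrite RintegralZl// (fiber_density_int gw) mulr1.
have M0 : 0 <= M by apply: (@ae_bound_ge0 _ _ _ m _ _ (aeW m uM)).
have Mhi : m.-integrable setT (EFin \o (fun x => M * `|fiber h w x|)).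
  exact: (integrableZl measurableT M (integrable_norm hi)).
have -> : \int[m]_x (M * fiber h w x) = \int[m]_x (M * `|fiber h w x|).
  rewrite /Rintegral; congr fine; apply: ae_eq_integral => //.
  - by case/integrableP: (integrableZl measurableT M hi).
  - by case/integrableP: Mhi.
  - by apply: filterS (fiber_density_ge0 gw) => x h0 _ /=; rewrite ger0_norm.
apply: le_Rintegral => //; first exact: integrable_norm.
by move=> x _; rewrite normrM mulrC ler_wpM2r.
Qed.

(** Equivariance in dual form: [Titer T n w] carries [mu_w] to the measure of the fibre over
    [shift n w]. Going one step at a time avoids substituting an almost everywhere identity inside
    [Liter]. *)
Lemma density_dual n w (u : X -> R) (M : R) : orbit_good w ->
  measurable_fun setT u -> (forall x, `|u x| <= M) ->
  \int[m]_x (fiber h w x * u (Titer T n w x)) =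
  \int[m]_x (fiber h (shift n%:Z w) x * u x).
Proof.
move=> gw; elim: n u => [|n IH] u mu uM; first by rewrite shift0.
have gn := gw n%:Z; have gSn := gw n.+1%:Z.
rewrite (IH (u \o T (shift n%:Z w))); last first.
- by move=> x; exact: uM.
- exact: (measurableT_comp mu (hTns _).1).
have [_ dual] := @Liter_dual 1 (shift n%:Z w) _ (density_L1 gn).
have := dual u M mu uM; rewrite /= shift0 => <-.
have [L11 _] := @Liter_dual 1 (shift n%:Z w) _ (density_L1 gn).
rewrite /Rintegral; congr fine; apply: ae_eq_integral => //.
- apply/measurable_EFinP; apply: measurable_funM => //.
  by case: L11 => -[]; rewrite /= shift0.
- apply/measurable_EFinP; apply: measurable_funM => //.
  by case: (density_L1 gSn) => -[].
- apply: filterS (fiber_equivariant gn) => x -> _ /=.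
  by rewrite shift_shift -PoszD addn1.
Qed.

Lemma Pi_opE w g : Pi_op m h w g =
  g \+ (fun x => (- cint m g) * real_fun (fiber h w) x).
Proof. by apply/funext => x; rewrite /Pi_op /= mulNr. Qed.

Lemma L1_Pi_op w g : fiber_good w -> L1 m g -> L1 m (Pi_op m h w g).
Proof.
by move=> gw g1; rewrite Pi_opE; apply: L1D => //; apply/L1Z/density_L1.
Qed.

Lemma Pi_op_integral n w g (u : X -> R) (M : R) : orbit_good w -> L1 m g ->
  measurable_fun setT u -> (forall x, `|u x| <= M) ->
  \int[m]_x (Re (Liter L n w (Pi_op m h w g) x) * u x) =
  \int[m]_x (Re (g x) * u (Titer T n w x)) -
  \int[m]_x Re (g x) * \int[m]_x (fiber h (shift n%:Z w) x * u x).
Proof.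
move=> gw g1 mu uM; have gw0 := orbit_good_fiber gw.
have [_ dual] := Liter_dual n w (L1_Pi_op gw0 g1).
rewrite (dual u M)// -(density_dual n gw mu uM).
have muT : measurable_fun setT (u \o Titer T n w).
  exact: (measurableT_comp mu (measurable_Titer n w)).
have i1 := integrableM_bounded (L1_Re g1) muT (fun x => uM _).
have i2 := integrableM_bounded (density_integrable gw0) muT (fun x => uM _).
rewrite -RintegralZl// -RintegralB//; last first.
  exact: (integrableZl measurableT _ i2).
apply: eq_Rintegral => x _.
by rewrite /Pi_op ReD ReN ReM_real_fun Re_cint mulrBl mulrA.
Qed.

Lemma phi_ae w : fiber_good w -> {ae m, forall x, `|phi (w, x)| <= C * (rho0 / K w)}.
Proof.
move=> gw; have : (normoo m (real_fun (fun x => phi (w, x))) <= (C * (rho0 / K w))%:E)%E.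
  apply: (le_trans (hC _)); rewrite EFinM lee_wpmul2l ?lee_fin//.
  exact: fiber_phi gw.
by move/normoo_leP; apply: filterS => x; rewrite normc_real.
Qed.

Lemma expR_gap (n : nat) : expR (- lambda * n%:R) * expR (eps * n%:R) =
  expR (- (lambda - eps) * n%:R) :> R.
Proof. by rewrite -expRD; congr expR; ring. Qed.

(** The difference is the pairing of [Liter L n w (Pi_op m h w g)] with [phi * u] on the arrival
    fibre. Decay bounds the first by [C * K w * expR (- lambda * n) * b], the factor [phi] is at
    most [C * rho0 / K (shift n w)], and the quotient of the two values of [K] is at most
    [expR (eps * n)]. Only the sup norm of [u] enters, so [u] may be the product of all later
    factors. *)
Lemma decay_pairing n w g (b : R) (u : X -> R) (M : R) : orbit_good w ->
  (bvnorm g <= b%:E)%E -> measurable_fun setT u -> (forall x, `|u x| <= M) ->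
  `|\int[m]_x (Re (g x) * (phi (iter n tau (w, x)) * u (Titer T n w x))) -
    \int[m]_x Re (g x) *
    \int[m]_x (fiber h (shift n%:Z w) x * (phi (shift n%:Z w, x) * u x))| <=
  C ^+ 2 * rho0 * M * expR (- (lambda - eps) * n%:R) * b.
Proof.
move=> gw gb mu uM; have gw0 := orbit_good_fiber gw; have gn := gw n%:Z.
have [g1 _] := bvnorm_leP gb.
have b0 : 0 <= b by rewrite -lee_fin (le_trans _ gb)// bvnorm_ge0.
have M0 : 0 <= M by apply: (@ae_bound_ge0 _ _ _ m _ _ (aeW m uM)).
pose f x := phi (shift n%:Z w, x) * u x.
have mpn := measurable_fiber (shift n%:Z w) mphi.
have mf : measurable_fun setT f by exact: measurable_funM.
have fM x : `|f x| <= B * M by rewrite normrM ler_pM.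
under eq_Rintegral do rewrite iter_skew.
rewrite -(Pi_op_integral n gw g1 mf fM).
have [L1G _] := Liter_dual n w (L1_Pi_op gw0 g1).
have Gb := fiber_decay gw0 n gb.
have Goo : (normoo m (Liter L n w (Pi_op m h w g)) <=
    (C * (K w * expR (- lambda * n%:R) * b))%:E)%E.
  by apply: (le_trans (hC _)); rewrite EFinM lee_wpmul2l ?lee_fin.
apply: le_norm_Rintegral_ae.
  by apply: measurable_funM => //; case: L1G => -[].
move/normoo_leP : Goo => Goo.
apply: filterS2 Goo (phi_ae gn) => x Gx px.
rewrite /f !normrM.
have hK := fiber_K gw0 n.
have e0 := expR_ge0 (- lambda * n%:R : R).
apply: (@le_trans _ _ ((C * (K w * expR (- lambda * n%:R) * b)) *
    ((C * (rho0 / K (shift n%:Z w))) * M))).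
  apply: ler_pM; rewrite ?mulr_ge0//; last by rewrite ler_pM.
  exact: le_trans (Re_le_normc _) Gx.
have -> : C * (K w * expR (- lambda * n%:R) * b) *
    (C * (rho0 / K (shift n%:Z w)) * M) =
    (C ^+ 2 * rho0 * M * b * expR (- lambda * n%:R)) * (K w / K (shift n%:Z w)).
  by field; rewrite gt_eqF.
have -> : C ^+ 2 * rho0 * M * expR (- (lambda - eps) * n%:R) * b =
    (C ^+ 2 * rho0 * M * b * expR (- lambda * n%:R)) * expR (eps * n%:R).
  by rewrite -expR_gap; ring.
rewrite ler_wpM2l//; last by rewrite ler_pdivrMr// mulrC.
by rewrite !mulr_ge0// sqr_ge0.
Qed.

(** [g'] plays the role of the [n]-step transfer of [g], written as its centred part plus its mean
    times the equivariant density. The two parts have [BV] norms at most [b] and [2 * b] times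
    [K (shift n w)], the first because [eps < lambda]. Multiplication by [phi] cancels this [K] and
    costs [2 * C], whence 6. Describing [g'] by its integrals suits operators determined only up to
    null sets. *)
Lemma transfer_step n w g (b : R) : orbit_good w -> (bvnorm g <= b%:E)%E ->
  exists g', (bvnorm (real_fun (fun x => phi (shift n%:Z w, x)) \* g')%R <=
      (6 * C * rho0 * b)%:E)%E /\
    forall (u : X -> R) (M : R), measurable_fun setT u -> (forall x, `|u x| <= M) ->
      \int[m]_x (Re (g' x) * u x) = \int[m]_x (Re (g x) * u (Titer T n w x)).
Proof.
move=> gw gb; have gw0 := orbit_good_fiber gw; have gn := gw n%:Z.
have [g1 _] := bvnorm_leP gb.
have b0 : 0 <= b by rewrite -lee_fin (le_trans _ gb)// bvnorm_ge0.
pose G := Liter L n w (Pi_op m h w g).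
have [L1G _] := Liter_dual n w (L1_Pi_op gw0 g1).
have hL1 := density_L1 gn.
exists (G \+ (fun x => cint m g * real_fun (fiber h (shift n%:Z w)) x)); split.
  have Gb := fiber_decay gw0 n gb.
  have cb : normc (cint m g) <= 2 * b.
    by apply: normc_cint_le => //; apply: le_trans gb; exact: norm1_le_bvnorm.
  have hb := bvnormZ_le hv (fiber_density gn) cb.
  have -> : 6 * C * rho0 * b = 2 * C * (rho0 / K (shift n%:Z w)) *
      (3 * b * K (shift n%:Z w)).
    by field; rewrite gt_eqF.
  apply: (bvnorm_mul_le hv C0 hC _ (fun x => phiB (_, x)) (fiber_phi gn)).
    exact: measurable_fiber.
  apply: (le_trans (bvnormD hv _ _)).
  apply: (le_trans (leeD Gb hb)).
  rewrite -EFinD lee_fin.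
  have -> : 3 * b * K (shift n%:Z w) =
    K (shift n%:Z w) * b + 2 * b * K (shift n%:Z w) by ring.
  rewrite lerD2r ler_wpM2r//.
  have := fiber_K gw0 n; have e0 := expR_gt0 (lambda * n%:R).
  rewrite mulNr expRN ler_pdivrMr// => /le_trans; apply.
  rewrite ler_wpM2l ?(ltW (K0 _))// ler_expR ler_wpM2r// ltW//.
move=> u M mu uM.
have i1 := integrableM_bounded (L1_Re L1G) mu uM.
have i2 := integrableM_bounded (density_integrable gn) mu uM.
transitivity (\int[m]_x (Re (G x) * u x) +
    Re (cint m g) * \int[m]_x (fiber h (shift n%:Z w) x * u x)).
  rewrite -RintegralZl// -RintegralD//; last first.
    exact: (integrableZl measurableT _ i2).
  by apply: eq_Rintegral => x _; rewrite /= ReD ReM_real_fun mulrDl mulrA.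
by rewrite (Pi_op_integral n gw g1 mu uM) Re_cint subrK.
Qed.

Definition fiber_mean l (w : paths Y) : R :=
  \int[m]_x (fiber h w x * obs phi tau l (w, x)).

Hypothesis mtau : measurable_fun setT tau.

Lemma measurable_fiber_gapprod l w :
  measurable_fun setT (fun x => gapprod phi tau l (w, x)).
Proof. by apply: measurable_fiber; exact: measurable_gapprod. Qed.

(* Induction on the past block [l1]: each of its factors is absorbed into the
   density by [transfer_step], the loss [K] of the transfer operator being
   compensated by the smallness of [phi]. *)
Lemma fiber_decorrelation l1 d l2 w g (b : R) : orbit_good w ->
  (bvnorm g <= b%:E)%E ->
  `|\int[m]_x (Re (g x) * gapprod phi tau (l1 ++ d :: l2) (w, x)) -
    \int[m]_x (Re (g x) * gapprod phi tau l1 (w, x)) *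
    fiber_mean l2 (shift (sumn l1 + d)%N%:Z w)| <=
  (6 * C * rho0) ^+ size l1 * (C ^+ 2 * rho0 * B ^+ size l2 *
    expR (- (lambda - eps) * d%:R)) * b.
Proof.
elim: l1 w g b => [|k l1 IH] w g b gw gb.
  rewrite expr0 mul1r /= add0n.
  have := decay_pairing d gw gb (measurable_fiber_gapprod l2 (shift d%:Z w))
    (fun x => @norm_gapprod _ _ phi tau B l2 _ phiB).
  congr (`| _ - _ * _ | <= _).
  - by apply: eq_Rintegral => x _; rewrite !iter_skew.
  - by apply: eq_Rintegral => x _; rewrite mulr1.
have [g' [g'b g'E]] := transfer_step k gw gb.
have gk := orbit_good_shift k%:Z gw.
have := IH _ _ _ gk g'b.
rewrite shift_shift -PoszD /= addnA.
have E l : \int[m]_x (Re ((real_fun (fun y => phi (shift k%:Z w, y)) \* g') x) *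
      gapprod phi tau l (shift k%:Z w, x)) =
    \int[m]_x (Re (g x) * (phi (iter k tau (w, x)) *
      gapprod phi tau l (iter k tau (w, x)))).
  transitivity (\int[m]_x (Re (g' x) * (phi (shift k%:Z w, x) *
      gapprod phi tau l (shift k%:Z w, x)))).
    by apply: eq_Rintegral => x _; rewrite /= [_ * g' x]mulrC ReM_real_fun mulrA.
  rewrite (g'E _ (B * B ^+ size l)).
  - by apply: eq_Rintegral => x _; rewrite iter_skew.
  - apply: measurable_funM; first exact: measurable_fiber.
    exact: measurable_fiber_gapprod.
  - by move=> x; rewrite normrM ler_pM// norm_gapprod.
rewrite !E; congr (_ <= _).
by rewrite [(6 * C * rho0) ^+ _.+1]exprS; ring.
Qed.

(** * From fibre expectations to expectations under [mu] *)

Variable P : probability (paths Y) R.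
Hypothesis hinv : shift_invariant P.
Hypothesis hgood : {ae P, forall w, orbit_good w}.
Variable mu : probability (paths Y * X)%type R.
Hypothesis hmu : is_mu m P h mu.
Hypothesis hB : B = C * rho0.

Let phiB' z : `|phi z| <= B. Proof. exact: phiB. Qed.

Let mobs l : measurable_fun setT (obs phi tau l).
Proof. by apply: measurable_funM => //; exact: measurable_gapprod. Qed.

Let B0 : 0 <= B. Proof. by rewrite hB mulr_ge0. Qed.

Lemma density_norm_int : {ae P, forall w, (\int[m]_x `|(h (w, x))%:E| = 1)%E}.
Proof.
apply: filterS hgood => w /orbit_good_fiber gw.
have hi := density_integrable gw.
transitivity (\int[m]_x (fiber h w x)%:E)%E.
  have mhw : measurable_fun setT (EFin \o fiber h w) by exact: measurable_int hi.
  apply: ae_eq_integral => //; first exact: measurableT_comp.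
  apply: filterS (fiber_density_ge0 gw) => x h0 _.
  by rewrite gee0_abs ?lee_fin.
have := fiber_density_int gw; rewrite /Rintegral => <-.
by rewrite fineK//; apply: integrable_fin_num.
Qed.

Lemma mixture_mean (f : paths Y * X -> R) (M : R) : measurable_fun setT f ->
  (forall z, `|f z| <= M) ->
  \int[mu]_z f z = \int[P]_w \int[m]_x (fiber h w x * f (w, x)).
Proof. exact: mixture_integral mh density_norm_int hmu _ _. Qed.

Lemma measurable_fiber_integral (f : paths Y * X -> R) (M : R) :
  measurable_fun setT f -> (forall z, `|f z| <= M) ->
  measurable_fun setT (fun w => \int[m]_x (fiber h w x * f (w, x))).
Proof.
move=> mf fM; apply: (@measurable_Rintegral_fiber _ _ _ _ _ P m (h \* f)).
exact: (integrableM_bounded (density_integrable_prod mh density_norm_int) mf fM).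
Qed.

Lemma measurable_fiber_mean l : measurable_fun setT (fiber_mean l).
Proof.
exact: measurable_fiber_integral (mobs l) (fun z => norm_obs tau l z phiB').
Qed.

Lemma norm_fiber_mean l w : fiber_good w -> `|fiber_mean l w| <= B ^+ (size l).+1.
Proof.
move=> gw; apply: norm_density_integral => //.
- by apply: measurable_fiber; exact: mobs.
- by move=> x; exact: norm_obs.
Qed.

Lemma ae_norm_fiber_mean l :
  {ae P, forall w, forall n, `|fiber_mean l (shift n w)| <= B ^+ (size l).+1}.
Proof. by apply: filterS hgood => w gw n; exact: norm_fiber_mean. Qed.

Lemma ae_norm_fiber_mean0 l :
  {ae P, forall w, `|fiber_mean l w| <= B ^+ (size l).+1}.
Proof. by apply: filterS hgood => w /orbit_good_fiber; exact: norm_fiber_mean. Qed.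

(** Invariance of [mu] under [tau] is derived here: [density_dual] moves the fibre integral to the
    fibre over [shift n w], and invariance of [P] removes the shift. *)
Lemma mixture_invariant n (f : paths Y * X -> R) (M : R) : measurable_fun setT f ->
  (forall z, `|f z| <= M) -> \int[mu]_z f (iter n tau z) = \int[mu]_z f z.
Proof.
move=> mf fM; have mn := measurable_iter n mtau.
have mfn : measurable_fun setT (f \o iter n tau) by exact: (measurableT_comp mf mn).
rewrite (mixture_mean mfn (fun z => fM _)) (mixture_mean mf fM).
pose u w := \int[m]_x (fiber h w x * f (w, x)).
have mu' : measurable_fun setT u by exact: measurable_fiber_integral mf fM.
have uM : {ae P, forall w, `|u w| <= M}.
  apply: filterS hgood => w /orbit_good_fiber gw.
  by apply: norm_density_integral => //; exact: measurable_fiber.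
rewrite -[RHS](Rintegral_shift hinv n%:Z mu' uM).
rewrite /Rintegral; congr fine; apply: ae_eq_integral => //.
- by apply/measurable_EFinP; exact: measurable_fiber_integral mfn (fun z => fM _).
- by apply/measurable_EFinP; exact: (measurableT_comp mu' (measurable_shift n%:Z)).
- apply: filterS hgood => w gw _; congr EFin.
  rewrite /u -(density_dual n gw (measurable_fiber (shift n%:Z w) mf) (fun x => fM _)).
  by apply: eq_Rintegral => x _; rewrite /= iter_skew.
Qed.

Lemma obs_mean l : \int[mu]_z obs phi tau l z = \int[P]_w fiber_mean l w.
Proof. exact: mixture_mean (mobs l) (fun z => norm_obs tau l z phiB'). Qed.

(** The starting function is [phi_w * h_w]: the bound [K w] on the density cancels against
    [rho0 / K w], so its [BV] norm is at most [2 * C * rho0], uniformly in [w]. *)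
Lemma fiber_mean_cat l1 d l2 w : orbit_good w ->
  `|fiber_mean (l1 ++ d :: l2) w -
    fiber_mean l1 w * fiber_mean l2 (shift (sumn l1 + d)%N%:Z w)| <=
  (6 * C * rho0) ^+ size l1 * (C ^+ 2 * rho0 * B ^+ size l2 *
    expR (- (lambda - eps) * d%:R)) * (2 * C * rho0).
Proof.
move=> gw; have gw0 := orbit_good_fiber gw.
have E l : fiber_mean l w = \int[m]_x
    (Re ((real_fun (fun y => phi (w, y)) \* real_fun (fiber h w)) x) *
     gapprod phi tau l (w, x)).
  apply: eq_Rintegral => x _.
  have -> : Re ((real_fun (fun y => phi (w, y)) \* real_fun (fiber h w)) x) =
      phi (w, x) * fiber h w x by rewrite /= mulr0 subr0.
  by rewrite /obs mulrA [fiber h w x * _]mulrC.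
rewrite !E; apply: fiber_decorrelation => //.
have -> : 2 * C * rho0 = 2 * C * (rho0 / K w) * K w.
  by field; rewrite gt_eqF.
apply: (bvnorm_mul_le hv C0 hC _ (fun x => phiB (_, x)) (fiber_phi gw0)).
  exact: measurable_fiber.
exact: fiber_density gw0.
Qed.

(** The block is observed [q] steps after starting from [m]. Unlike [fiber_mean], it does not
    involve [h_w] and reads finitely many coordinates of [w]. *)
Definition start_mean l q (w : paths Y) : R :=
  \int[m]_x obs phi tau l (iter q tau (w, x)).

Let mobsq l q : measurable_fun setT (fun z => obs phi tau l (iter q tau z)).
Proof. exact: (measurableT_comp (mobs l) (measurable_iter q mtau)). Qed.

Lemma measurable_start_mean l q : measurable_fun setT (start_mean l q).
Proof.
apply: (@measurable_Rintegral_fiber _ _ _ _ _ P m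
  (fun z => obs phi tau l (iter q tau z))).
exact: bounded_integrable (mobsq l q) (fun z => norm_obs tau l _ phiB').
Qed.

Lemma norm_start_mean l q w : `|start_mean l q w| <= B ^+ (size l).+1.
Proof.
apply: le_norm_Rintegral => [|x]; last exact: norm_obs.
exact: measurable_fiber (mobsq l q).
Qed.

(** This is [decay_pairing] for [g = 1], whose mean is 1, started on the fibre over
    [shift (- q) w]. *)
Lemma fiber_mean_approx l q w : orbit_good w ->
  `|fiber_mean l w - start_mean l q (shift (- q%:Z) w)| <=
  C ^+ 2 * rho0 * B ^+ size l * expR (- (lambda - eps) * q%:R).
Proof.
move=> gw; have gq := orbit_good_shift (- q%:Z) gw.
have n1 : (bvnorm (fun=> 1%R) <= 1%:E)%E by rewrite (bvnorm_cst1 hv).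
have := decay_pairing q gq n1 (measurable_fiber_gapprod l w)
  (fun x => @norm_gapprod _ _ phi tau B l _ phiB).
rewrite shift_shift addNr shift0 mulr1 distrC; congr (`| _ - _ | <= _).
  rewrite /= Rintegral_cst_prob mul1r.
  by apply: eq_Rintegral => x _.
apply: eq_Rintegral => x _.
rewrite /= mul1r /obs; congr (_ * gapprod _ _ _ _).
by rewrite iter_skew shift_shift addNr shift0.
Qed.

(** The factor 2 counts the two parts of a covariance, the mean of the product and the product of
    the means; in each, one factor is replaced at a time. *)
Lemma cov_perturb (u1 u2 a c : paths Y -> R) (M1 M2 e1 e2 : R) :
  measurable_fun setT u1 -> measurable_fun setT u2 ->
  measurable_fun setT a -> measurable_fun setT c ->
  {ae P, forall w, `|u1 w| <= M1} -> (forall w, `|c w| <= M2) ->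
  {ae P, forall w, `|u1 w - a w| <= e1} -> {ae P, forall w, `|u2 w - c w| <= e2} ->
  {ae P, forall w, `|u2 w| <= M2} -> (forall w, `|a w| <= M1) ->
  `|cov P u1 u2| <= `|cov P a c| + 2 * (M1 * e2 + e1 * M2).
Proof.
move=> mu1 mu2 ma mc u1M cM ua uc u2M aM.
have i1 := ae_bounded_integrable mu1 u1M.
have i2 := ae_bounded_integrable mu2 u2M.
have ia := bounded_integrable P ma aM.
have ic := bounded_integrable P mc cM.
have m12 : measurable_fun setT (fun w => u1 w * u2 w) by exact: measurable_funM.
have mac : measurable_fun setT (fun w => a w * c w) by exact: measurable_funM.
have i12 : P.-integrable setT (EFin \o (fun w => u1 w * u2 w)).
  apply: (@ae_bounded_integrable _ _ _ P _ (M1 * M2)) => //.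
  by apply: filterS2 u1M u2M => w h1 h2; rewrite normrM ler_pM.
have iac : P.-integrable setT (EFin \o (fun w => a w * c w)).
  apply: (@bounded_integrable _ _ _ P _ (M1 * M2)) => // w.
  by rewrite normrM ler_pM.
have d12 : `|\int[P]_w (u1 w * u2 w) - \int[P]_w (a w * c w)| <= M1 * e2 + e1 * M2.
  rewrite -RintegralB//; apply: le_norm_Rintegral_ae; first exact: measurable_funB.
  apply: filterS3 u1M ua uc => w h1 h2 h3.
  have -> : u1 w * u2 w - a w * c w = u1 w * (u2 w - c w) + (u1 w - a w) * c w by ring.
  by apply: (le_trans (ler_normD _ _)); rewrite !normrM lerD// ler_pM.
have d1 : `|\int[P]_w u1 w - \int[P]_w a w| <= e1.
  rewrite -RintegralB//; apply: le_norm_Rintegral_ae => //.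
  exact: measurable_funB.
have d2 : `|\int[P]_w u2 w - \int[P]_w c w| <= e2.
  rewrite -RintegralB//; apply: le_norm_Rintegral_ae => //.
  exact: measurable_funB.
have dd : `|(\int[P]_w u1 w) * (\int[P]_w u2 w) - (\int[P]_w a w) * (\int[P]_w c w)|
    <= M1 * e2 + e1 * M2.
  have -> : (\int[P]_w u1 w) * (\int[P]_w u2 w) - (\int[P]_w a w) * (\int[P]_w c w) =
    (\int[P]_w u1 w) * (\int[P]_w u2 w - \int[P]_w c w) +
    (\int[P]_w u1 w - \int[P]_w a w) * (\int[P]_w c w) by ring.
  apply: (le_trans (ler_normD _ _)); rewrite !normrM lerD// ler_pM//.
    exact: le_norm_Rintegral_ae.
  exact: le_norm_Rintegral.
have -> : cov P u1 u2 = cov P a c +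
    ((\int[P]_w (u1 w * u2 w) - \int[P]_w (a w * c w)) -
     ((\int[P]_w u1 w) * (\int[P]_w u2 w) - (\int[P]_w a w) * (\int[P]_w c w))).
  by rewrite /cov; ring.
apply: (le_trans (ler_normD _ _)); rewrite lerD2l.
by apply: (le_trans (ler_normB _ _)); rewrite mulr_natl mulr2n lerD.
Qed.

(** * Dependence on finitely many coordinates and decorrelation across one gap *)

Hypothesis hT0 : forall w w' : paths Y, w 0 = w' 0 -> T w = T w'.
Hypothesis hphi0 : forall (w w' : paths Y) x, w 0 = w' 0 -> phi (w, x) = phi (w', x).

Lemma Titer_depends n (w w' : paths Y) x :
  (forall j : int, 0 <= j < n%:Z -> w j = w' j) -> Titer T n w x = Titer T n w' x.
Proof.
elim: n => [//|n IH] ww' /=.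
rewrite IH; last first.
  by move=> j /andP[j0 jn]; apply: ww'; rewrite j0 (lt_trans jn)// ltz_nat.
rewrite (@hT0 (shift n%:Z w) (shift n%:Z w'))// /shift add0r.
by apply: ww'; rewrite ltz_nat ltnSn andbT.
Qed.

(** The range is closed, against the half-open one for [Titer], because [phi] also reads the
    coordinate at the last time. *)
Lemma gapprod_depends l (w w' : paths Y) x :
  (forall j : int, 0 <= j <= (sumn l)%:Z -> w j = w' j) ->
  gapprod phi tau l (w, x) = gapprod phi tau l (w', x).
Proof.
elim: l w w' x => [//|d l IH] w w' x ww' /=.
rewrite !iter_skew (@Titer_depends _ w w'); last first.
  move=> j /andP[j0 jd]; apply: ww'; rewrite j0 (le_trans (ltW jd))//.
  by rewrite lez_nat leq_addr.
congr (_ * _).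
  apply: hphi0; rewrite /shift add0r; apply: ww'.
  by rewrite lez_nat leq_addr andbT.
apply: IH => j /andP[j0 jl]; rewrite /shift; apply: ww'.
by rewrite addr_ge0//= PoszD addrC lerD2l.
Qed.

Lemma start_mean_depends l q (w w' : paths Y) :
  (forall j : int, 0 <= j <= (q + sumn l)%:Z -> w j = w' j) ->
  start_mean l q w = start_mean l q w'.
Proof.
move=> ww'; apply: eq_Rintegral => x _; rewrite !iter_skew.
rewrite (@Titer_depends _ w w'); last first.
  move=> j /andP[j0 jq]; apply: ww'; rewrite j0 (le_trans (ltW jq))//.
  by rewrite lez_nat leq_addr.
congr (_ * _).
  apply: hphi0; rewrite /shift add0r; apply: ww'.
  by rewrite lez_nat leq_addr andbT.
apply: gapprod_depends => j /andP[j0 jl]; apply: ww'.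
by rewrite addr_ge0//= PoszD addrC lerD2l.
Qed.

Context {dS : measure_display} {S : measurableType dS}.
Variables (PP : probability S R) (xi : int -> S -> Y).
Hypothesis hxi : forall j, measurable_fun setT (xi j).
Hypothesis hP : is_law PP xi P.

Lemma gap_decorrelation l1 d l2 (b : R) : 0 < b -> b <= d%:R ->
  `|\int[mu]_z obs phi tau (l1 ++ d :: l2) z -
    (\int[mu]_z obs phi tau l1 z) * (\int[mu]_z obs phi tau l2 z)| <=
  5 * (6 * C ^+ 2 * rho0) ^+ (size l1 + size l2).+2 * gamma_ PP xi lambda eps b.
Proof.
move=> b0 bd; rewrite /gamma_.
set k := Num.truncn (b / 3); set E := expR _.
(* [k] steps may fall short of [b / 3], so relaxation takes one more; [truncn_third] still leaves
   [k] steps of the gap for mixing. *)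
pose q := k.+1; pose s := (sumn l1 + d)%N.
have b3 : 0 <= b / 3 by rewrite divr_ge0// ltW.
have bq : b / 3 < q%:R by exact: truncnS_gt.
have dkq : (k + q <= d)%N by exact: truncn_third.
have dlt : 0 < lambda - eps by rewrite subr_gt0.
have Ele (n : nat) : b / 3 <= n%:R -> expR (- (lambda - eps) * n%:R) <= E.
  move=> bn; rewrite ler_expR -mulrA !mulNr lerN2 ler_pM2l//.
have Eq : expR (- (lambda - eps) * q%:R) <= E by apply: Ele; exact: ltW.
have Ed : expR (- (lambda - eps) * d%:R) <= E.
  by apply: Ele; apply: le_trans bd; rewrite ler_pdivrMr// ler_peMr// ?(ltW b0)// ler1n.
have E0 : 0 <= E by exact: expR_ge0.
pose u1 := fiber_mean l1; pose u2 w := fiber_mean l2 (shift s%:Z w).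
pose a w := start_mean l1 q (shift (- q%:Z) w).
pose c w := start_mean l2 q (shift (s%:Z - q%:Z) w).
pose N1 := (size l1).+1; pose N2 := (size l2).+1.
pose e1 := C ^+ 2 * rho0 * B ^+ size l1 * E.
pose e2 := C ^+ 2 * rho0 * B ^+ size l2 * E.
have mu1 : measurable_fun setT u1 by exact: measurable_fiber_mean.
have mu2 : measurable_fun setT u2.
  exact: (measurableT_comp (measurable_fiber_mean l2) (measurable_shift _)).
have ma : measurable_fun setT a.
  exact: (measurableT_comp (measurable_start_mean l1 q) (measurable_shift _)).
have mc : measurable_fun setT c.
  exact: (measurableT_comp (measurable_start_mean l2 q) (measurable_shift _)).
have aM w : `|a w| <= B ^+ N1 by exact: norm_start_mean.
have cM w : `|c w| <= B ^+ N2 by exact: norm_start_mean.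
have u1M : {ae P, forall w, `|u1 w| <= B ^+ N1} by exact: ae_norm_fiber_mean0.
have u2M : {ae P, forall w, `|u2 w| <= B ^+ N2}.
  by apply: filterS (ae_norm_fiber_mean l2) => w /(_ s%:Z).
have C2r : 0 <= C ^+ 2 * rho0 by rewrite mulr_ge0// sqr_ge0.
have ua : {ae P, forall w, `|u1 w - a w| <= e1}.
  apply: filterS hgood => w gw; apply: (le_trans (fiber_mean_approx l1 q gw)).
  by rewrite ler_wpM2l// mulr_ge0// exprn_ge0.
have uc : {ae P, forall w, `|u2 w - c w| <= e2}.
  apply: filterS hgood => w gw.
  have := fiber_mean_approx l2 q (orbit_good_shift s%:Z gw).
  rewrite shift_shift => /le_trans; apply.
  by rewrite ler_wpM2l// mulr_ge0// exprn_ge0.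
have Eu2 : \int[P]_w u2 w = \int[P]_w fiber_mean l2 w.
  exact: (Rintegral_shift hinv _ (measurable_fiber_mean l2) (ae_norm_fiber_mean0 l2)).
rewrite !obs_mean -Eu2.
(* Since [C >= 1], this [M] dominates every constant that occurs: [B], [6 * C * rho0],
   [2 * C * rho0] and [C ^+ 2 * rho0]. *)
pose M := 6 * C ^+ 2 * rho0.
have M0 : 0 <= M by rewrite /M -mulrA mulr_ge0.
have C1 := normoo_const_ge1.
have CC : C <= C ^+ 2 by rewrite expr2 ler_peMl.
have C6 : C ^+ 2 <= 6 * C ^+ 2 by rewrite ler_peMl ?sqr_ge0// ler1n.
have BM : 0 <= B <= M by rewrite B0 hB /M ler_wpM2r// (le_trans CC).
have CM : 0 <= 6 * C * rho0 <= M.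
  by rewrite !mulr_ge0//= /M ler_wpM2r// ler_wpM2l.
have CM2 : 0 <= 2 * C * rho0 <= M.
  rewrite !mulr_ge0//=; case/andP: CM => _; apply: le_trans.
  by rewrite -!mulrA ler_wpM2r ?mulr_ge0// ler_nat.
have C2M : 0 <= C ^+ 2 * rho0 <= M by rewrite C2r /M ler_wpM2r.
have m12 : measurable_fun setT (fun w => u1 w * u2 w) by exact: measurable_funM.
have i12 : P.-integrable setT (EFin \o (fun w => u1 w * u2 w)).
  apply: (@ae_bounded_integrable _ _ _ P _ (B ^+ N1 * B ^+ N2)) => //.
  by apply: filterS2 u1M u2M => w h1 h2; rewrite normrM ler_pM.
have i3 := ae_bounded_integrable (measurable_fiber_mean (l1 ++ d :: l2))
  (ae_norm_fiber_mean0 _).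
have step1 : `|\int[P]_w fiber_mean (l1 ++ d :: l2) w - \int[P]_w (u1 w * u2 w)| <=
    M ^+ (size l1 + size l2).+2 * E.
  rewrite -RintegralB//; apply: le_norm_Rintegral_ae.
    by apply: measurable_funB => //; exact: measurable_fiber_mean.
  apply: filterS hgood => w gw; apply: (le_trans (fiber_mean_cat l1 d l2 gw)).
  have -> : (6 * C * rho0) ^+ size l1 * (C ^+ 2 * rho0 * B ^+ size l2 *
     expR (- (lambda - eps) * d%:R)) * (2 * C * rho0) =
    ((6 * C * rho0) ^+ size l1 * ((2 * C * rho0) * (C ^+ 2 * rho0 * B ^+ size l2))) *
     expR (- (lambda - eps) * d%:R) by ring.
  apply: ler_pM Ed; rewrite ?expR_ge0//; last exact: ler_expM4.
  by rewrite !mulr_ge0 ?exprn_ge0// ?mulr_ge0 ?sqr_ge0.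
have step2 : `|cov P a c| <= 4 * B ^+ N1 * B ^+ N2 * alpha PP xi k.
  (* [a] reads coordinates up to [sumn l1], and [c] reads from [s - q] on. After this translation
     they read coordinates at most 0 and at least [d - q >= k], as in the definition of [alpha]. *)
  pose sg := - (sumn l1)%:Z.
  have mac : measurable_fun setT (fun w => a w * c w) by exact: measurable_funM.
  have acM w : `|a w * c w| <= B ^+ N1 * B ^+ N2 by rewrite normrM ler_pM.
  have -> : cov P a c = cov P (fun w => a (shift sg w)) (fun w => c (shift sg w)).
    rewrite /cov (Rintegral_shift hinv sg mac (aeW P acM)).
    by rewrite (Rintegral_shift hinv sg ma (aeW P aM))
      (Rintegral_shift hinv sg mc (aeW P cM)).
  apply: (cov_le_alpha hxi hP _ (fun w => aM _) _ (fun w => cM _)).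
  - exact: (measurableT_comp ma (measurable_shift _)).
  - exact: (measurableT_comp mc (measurable_shift _)).
  - move=> w w' ww'; apply: start_mean_depends => j /andP[j0 jq].
    apply: ww'; clear -jq; rewrite /sg /=; lia.
  - move=> w w' ww'; apply: start_mean_depends => j /andP[j0 jq].
    apply: ww'; clear -j0 dkq; rewrite /sg /s /=; lia.
have step3 := cov_perturb mu1 mu2 ma mc u1M cM ua uc u2M aM.
have a0 : 0 <= alpha PP xi k by exact: alpha_ge0.
have Be2 : B ^+ N1 * e2 <= M ^+ (size l1 + size l2).+2 * E.
  have -> : B ^+ N1 * e2 =
    (B ^+ size l1 * (B * (C ^+ 2 * rho0 * B ^+ size l2))) * E.
    by rewrite /N1 /e2 exprSr; ring.
  by rewrite ler_wpM2r//; exact: ler_expM4.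
have Be1 : e1 * B ^+ N2 <= M ^+ (size l1 + size l2).+2 * E.
  have -> : e1 * B ^+ N2 =
    (B ^+ size l1 * ((C ^+ 2 * rho0) * (B * B ^+ size l2))) * E.
    by rewrite /N2 /e1 [B ^+ (size l2).+1]exprS; ring.
  by rewrite ler_wpM2r//; exact: ler_expM4.
have Ba : 4 * B ^+ N1 * B ^+ N2 * alpha PP xi k <=
    4 * M ^+ (size l1 + size l2).+2 * alpha PP xi k.
  rewrite ler_wpM2r// -!mulrA ler_wpM2l//.
  have -> : B ^+ N1 * B ^+ N2 = B ^+ size l1 * (B * (B * B ^+ size l2)).
    by rewrite /N1 /N2 exprSr exprS; ring.
  exact: ler_expM4.
rewrite -/M.
have -> : \int[P]_w fiber_mean (l1 ++ d :: l2) w - \int[P]_w u1 w * \int[P]_w u2 w =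
  (\int[P]_w fiber_mean (l1 ++ d :: l2) w - \int[P]_w (u1 w * u2 w)) + cov P u1 u2.
  by rewrite /cov addrA subrK.
apply: (le_trans (ler_normD _ _)).
apply: (combine_errors step1 step3 step2 Ba Be2 Be1).
by rewrite mulr_ge0// exprn_ge0.
Qed.

(** The truncated subtraction is exact on sorted lists of times, the case in which [obs_gaps]
    applies. *)
Let gaps i (s : seq nat) := pairmap (fun x y => (y - x)%N) i s.

Lemma obs_gaps i s z : path leq i s ->
  \prod_(j <- i :: s) phi (iter j tau z) = obs phi tau (gaps i s) (iter i tau z).
Proof.
elim: s i => [|k s IH] i /=.
  by rewrite big_cons big_nil.
move=> /andP[ik ks]; rewrite big_cons (IH k ks) /obs /= -iterD subnK//.
Qed.

(** * Finite sets of times as blocks *)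

Section blocks.
Variable n : nat.
Implicit Types V W : {set 'I_n}.

Definition block_obs V (z : paths Y * X) : R := \prod_(i in V) phi (iter i tau z).

Definition block_mean V : R := \int[mu]_z block_obs V z.

Let times V := sort leq [seq val i | i <- enum V].

Let block_obs_times V z :
  block_obs V z = \prod_(j <- times V) phi (iter j tau z).
Proof.
rewrite /times (perm_big _ (permEl (perm_sort leq [seq val i | i <- enum V]))).
by rewrite big_map big_enum.
Qed.

Let size_times V : size (times V) = #|V|.
Proof. by rewrite size_sort size_map -cardE. Qed.

Let sorted_times V : sorted leq (times V).
Proof. by apply: sort_sorted; exact: leq_total. Qed.

Let mem_times V (j : nat) : j \in times V -> exists2 i : 'I_n, i \in V & j = i.
Proof. by rewrite mem_sort => /seq.mapP[k]; rewrite mem_enum => kV ->; exists k. Qed.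

Lemma measurable_block_obs V : measurable_fun setT (block_obs V).
Proof.
have -> : block_obs V = fun z => \prod_(i <- enum V) phi (iter i tau z).
  by apply/funext => z; rewrite /block_obs -big_enum.
by apply: measurable_prod => i _; exact: (measurableT_comp mphi (measurable_iter i mtau)).
Qed.

Lemma norm_block_obs V z : `|block_obs V z| <= B ^+ #|V|.
Proof.
rewrite /block_obs normr_prod -prodr_const; apply: ler_prod => i _.
by rewrite normr_ge0 phiB.
Qed.

Lemma norm_block_mean V : `|block_mean V| <= B ^+ #|V|.
Proof.
by apply: le_norm_Rintegral; [exact: measurable_block_obs|exact: norm_block_obs].
Qed.

Lemma block_mean0 : block_mean finset.set0 = 1.
Proof.
rewrite /block_mean (@eq_Rintegral _ _ _ mu setT (fun=> 1)) ?Rintegral_cst_prob// => z _.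
by rewrite /block_obs big_set0.
Qed.

(** Invariance of [mu] moves the first time of each block to 0, so only gap sequences remain; the
    distinguished gap runs from the last time of [V] to the first time of [V']. *)
Lemma block_decorrelation V V' (b : R) : V != finset.set0 -> V' != finset.set0 ->
  0 < b -> (forall i j, i \in V -> j \in V' -> (i < j)%N /\ b <= (j - i)%N%:R) ->
  `|block_mean (V :|: V')%SET - block_mean V * block_mean V'| <=
  5 * (6 * C ^+ 2 * rho0) ^+ (#|V| + #|V'|)%N * gamma_ PP xi lambda eps b.
Proof.
move=> V0 V'0 b0 hVV'.
have dVV' : [disjoint V & V']%bool.
  apply/pred0P => i /=; apply/negP => /andP[iS iS'].
  by have [] := hVV' _ _ iS iS'; rewrite ltnn.
have := size_times V; have := sorted_times V; have := @mem_times V.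
have := block_obs_times V.
case: (times V) => [|i s] EV memS srtV szS.
  by move: V0; rewrite -cards_eq0 -szS.
have := size_times V'; have := sorted_times V'; have := @mem_times V'.
have := block_obs_times V'.
case: (times V') => [|k t] EV' memS' srtV' szS'.
  by move: V'0; rewrite -cards_eq0 -szS'.
have [i1 i1S i1E] := memS _ (mem_last i s).
have [k1 k1S k1E] := memS' k (mem_head _ _).
have [lk bk] := hVV' _ _ i1S k1S; rewrite -i1E -k1E in lk bk.
have pU : path leq i (s ++ k :: t).
  by rewrite cat_path/= (ltnW lk) /=; apply/andP; split.
have gU : gaps i (s ++ k :: t) = gaps i s ++ (k - last i s)%N :: gaps k t.
  by rewrite /gaps pairmap_cat.
have EU z : block_obs (V :|: V')%SET z =
    obs phi tau (gaps i s ++ (k - last i s)%N :: gaps k t) (iter i tau z).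
  rewrite -gU -obs_gaps// -cat_cons big_cat/= -EV -EV' /block_obs.
  by rewrite -bigU//=; apply: eq_bigl => j; rewrite !inE.
have := gap_decorrelation (gaps i s) (gaps k t) b0 bk.
have sz i' s' : size (gaps i' s') = size s' by rewrite size_pairmap.
rewrite !sz -addnS -addSn -[(size s).+1]/(size (i :: s)) -[(size t).+1]/(size (k :: t)).
rewrite szS szS'; congr (`| _ - _ * _ | <= _).
- rewrite -(mixture_invariant i (mobs _) (fun z => norm_obs tau _ z phiB)).
  by apply: eq_Rintegral => z _; rewrite EU.
- rewrite -(mixture_invariant i (mobs _) (fun z => norm_obs tau _ z phiB)).
  by apply: eq_Rintegral => z _; rewrite EV obs_gaps.
- rewrite -(mixture_invariant k (mobs _) (fun z => norm_obs tau _ z phiB)).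
  by apply: eq_Rintegral => z _; rewrite EV' obs_gaps.
Qed.

(** * Interleaved families by induction on the number of points *)

Section coloring.
Variables (J : finType) (kappa : 'I_n -> J) (b : R).
Hypothesis b0 : 0 < b.

(** A family of disjoint blocks becomes a coloring of its points: the separation hypothesis then
    passes to subsets, and a class emptied during the induction contributes the factor 1. *)
Let cls W j : {set 'I_n} := [set x in W | kappa x == j]%SET.

Let M := 6 * C ^+ 2 * rho0.

Let M_ge0 : 0 <= M.
Proof. by rewrite /M !mulr_ge0// sqr_ge0. Qed.

Let BM : B <= M.
Proof.
rewrite hB /M ler_wpM2r// expr2 mulrA ler_peMl//.
have C1 := normoo_const_ge1.
by rewrite (le_trans C1)// ler_peMl// ler1n.
Qed.

Let block_mean_le V : `|block_mean V| <= M ^+ #|V|.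
Proof. by apply: (le_trans (norm_block_mean V)); exact: lerXn2r. Qed.

Let gam := gamma_ PP xi lambda eps b.

(* [E'] is the maximal final segment of [W] inside one class: the class of the
   preceding point differs, so [E'] is at distance at least [b] from the rest
   of [W], and both sides of the estimate factor over [E'] up to one error. *)
Lemma coloring_decorrelation W :
  (forall x y, x \in W -> y \in W -> kappa x != kappa y ->
     b <= `|(x : nat)%:Z - (y : nat)%:Z|%N%:R) ->
  `|block_mean W - \prod_(j : J) block_mean (cls W j)| <=
  10 * #|W|.-1%:R * M ^+ #|W| * gam.
Proof.
have [N] := ubnP #|W|; elim: N W => // N IH W /ltnSE WN hW.
have g0 : 0 <= gam by exact: (gamma_ge0 PP hxi).
have R0 : 0 <= 10 * #|W|.-1%:R * M ^+ #|W| * gam.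
  by rewrite !mulr_ge0 ?exprn_ge0.
have [->|/set0Pn[t1 t1W]] := eqVneq W finset.set0.
  rewrite block_mean0 big1 ?subrr ?normr0.
    by rewrite !mulr_ge0 ?exprn_ge0.
  move=> j _; have -> : cls finset.set0 j = finset.set0; last exact: block_mean0.
  by apply/finset.setP => x; rewrite !inE.
have [t0 t0W t0max] : exists2 t0, t0 \in W & forall y, y \in W -> (y <= t0)%N.
  exists [arg max_(i > t1 in W) (i : nat)]%N; case: arg_maxnP => //.
pose j0 := kappa t0.
pose E' : {set 'I_n} := [set x in W | [forall y in W, (x <= y)%N ==> (kappa y == j0)]]%SET.
pose E : {set 'I_n} := (W :\: E')%SET.
have E'W : E' \subset W by apply/fintype.subsetP => x; rewrite inE => /andP[].
have WE : W = (E :|: E')%SET.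
  by rewrite /E finset.setUC -{1}(finset.setID W E') (finset.setIidPr E'W).
have t0E' : t0 \in E'.
  rewrite inE t0W/=; apply/forall_inP => y yW; apply/implyP => ty.
  suff -> : y = t0 by [].
  by apply/val_inj/eqP; rewrite eqn_leq ty t0max.
have E'j x : x \in E' -> kappa x = j0.
  by rewrite inE => /andP[xW /forall_inP /(_ x xW)]; rewrite leqnn => /eqP.
(* A point [x] of [E] has some [z >= x] in [W] whose color is not [j0]. This [z] precedes [y], so
   [y - x >= y - z >= b]. *)
have sep x y : x \in E -> y \in E' -> (x < y)%N /\ b <= (y - x)%N%:R.
  rewrite !inE => /andP[+ xW]; rewrite xW/= => /forall_inPn[z zW].
  rewrite negb_imply => /andP[xz kz] /andP[yW /forall_inP hy].
  have zy : (z < y)%N.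
    by rewrite ltnNge; apply/negP => yz; move: (hy z zW); rewrite yz (negbTE kz).
  have ky : kappa y = j0.
    by move: (hy y yW); rewrite leqnn => /eqP.
  split; first exact: leq_ltn_trans xz zy.
  have := hW z y zW yW; rewrite ky => /(_ kz) /le_trans; apply.
  rewrite ler_nat distnC distnEl ?(ltnW zy)//.
  exact: leq_sub2l.
have dEE' : [disjoint E & E']%bool by rewrite /E -finset.setI_eq0 finset.setIDAC finset.setDIl finset.setDv finset.setI0.
have cW : #|W| = (#|E| + #|E'|)%N.
  by rewrite {1}WE cardsU (eqP (_ : E :&: E' == finset.set0)%SET) ?cards0 ?subn0// finset.setI_eq0.
have E'0 : E' != finset.set0 by apply/set0Pn; exists t0.
have cE' : (0 < #|E'|)%N by rewrite card_gt0.
have clsj j : j != j0 -> cls W j = cls E j.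
  move=> jj0; apply/finset.setP => x; rewrite !inE.
  apply/andP/andP => [[xW /eqP xj]|[/andP[_ xW] xj]]; last by rewrite xW.
  rewrite xW xj eqxx andbT; split=> //; apply/negP => /forall_inP /(_ x xW).
  by rewrite leqnn/= xj (negbTE jj0).
have clsj0 : cls W j0 = (cls E j0 :|: E')%SET.
  apply/finset.setP => x; rewrite 2!inE [in RHS]inE [in RHS]inE.
  have [xE'|xE'] := boolP (x \in E').
    by rewrite (fintype.subsetP E'W _ xE') (E'j _ xE') eqxx orbT.
  by rewrite /= orbF.
have clsE j : cls E j \subset E by apply/fintype.subsetP => x; rewrite inE => /andP[].
have [E0|E0] := eqVneq E finset.set0.
  have WE' : W = E' by rewrite WE E0 finset.set0U.
  rewrite (bigD1 j0)//= big1 ?mulr1.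
    have -> : cls W j0 = W.
      by apply/finset.setP => x; rewrite inE WE' andb_idr// => /E'j ->.
    by rewrite subrr normr0.
  move=> j jj0; rewrite clsj// E0.
  have -> : cls finset.set0 j = finset.set0; last exact: block_mean0.
  by apply/finset.setP => x; rewrite !inE.
have cE : (0 < #|E|)%N by rewrite card_gt0.
pose Q := \prod_(j | j != j0) block_mean (cls E j).
have EW : \prod_j block_mean (cls W j) = block_mean (cls W j0) * Q.
  by rewrite (bigD1 j0)//=; congr (_ * _); apply: eq_bigr => j /clsj ->.
have EE : \prod_j block_mean (cls E j) = block_mean (cls E j0) * Q.
  by rewrite (bigD1 j0).
have cEsum : #|E| = (#|cls E j0| + \sum_(j | j != j0) #|cls E j|)%N.
  transitivity (\sum_j #|cls E j|)%N; last by rewrite (bigD1 j0).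
  rewrite -sum1_card (partition_big kappa xpredT)//=.
  by apply: eq_bigr => j _; rewrite -sum1_card; apply: eq_bigl => x; rewrite !inE.
have QM : `|Q| <= M ^+ (\sum_(j | j != j0) #|cls E j|)%N.
  rewrite /Q normr_prod expr_sum; apply: ler_prod => j _.
  by rewrite normr_ge0 block_mean_le.
have ltE : (#|E| < N.+1)%N by rewrite ltnS (leq_trans _ WN)// cW leq_addr.
(* [E'] is split off twice, from [W] here and from its own class in [err3]. The two errors with
   constant 5 make up the 10 of the induction step. *)
have err1 : `|block_mean W - block_mean E * block_mean E'| <= 5 * M ^+ #|W| * gam.
  by rewrite {1}WE cW; exact: block_decorrelation.
have err2 : `|block_mean E - block_mean (cls E j0) * Q| <=
    10 * #|E|.-1%:R * M ^+ #|E| * gam.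
  rewrite -EE; apply: IH.
    by rewrite (leq_trans _ WN)// cW -addn1 leq_add2l.
  move=> x y xE yE; apply: hW; rewrite WE inE ?xE ?yE//.
have err3 : `|block_mean (cls W j0) - block_mean (cls E j0) * block_mean E'| <=
    5 * M ^+ (#|cls E j0| + #|E'|)%N * gam.
  rewrite clsj0; have [->|C0'] := eqVneq (cls E j0) finset.set0.
    rewrite finset.set0U block_mean0 mul1r subrr normr0.
    by rewrite !mulr_ge0 ?exprn_ge0.
  apply: block_decorrelation => // x y xE; apply: sep.
  exact: (fintype.subsetP (clsE j0)).
rewrite EW.
have -> : block_mean W - block_mean (cls W j0) * Q =
  (block_mean W - block_mean E * block_mean E') +
  ((block_mean E - block_mean (cls E j0) * Q) * block_mean E' -
   (block_mean (cls W j0) - block_mean (cls E j0) * block_mean E') * Q) by ring.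
apply: (le_trans (ler_normD _ _)).
have err2' : `|(block_mean E - block_mean (cls E j0) * Q) * block_mean E'| <=
    10 * #|E|.-1%:R * M ^+ #|W| * gam.
  rewrite normrM cW exprD.
  have -> : 10 * #|E|.-1%:R * (M ^+ #|E| * M ^+ #|E'|) * gam =
    (10 * #|E|.-1%:R * M ^+ #|E| * gam) * M ^+ #|E'| by ring.
  by rewrite ler_pM.
have err3' : `|(block_mean (cls W j0) - block_mean (cls E j0) * block_mean E') * Q| <=
    5 * M ^+ #|W| * gam.
  rewrite normrM cW cEsum addnAC exprD.
  have -> : 5 * (M ^+ (#|cls E j0| + #|E'|)%N * M ^+ (\sum_(j | j != j0) #|cls E j|)%N) * gam =
    (5 * M ^+ (#|cls E j0| + #|E'|)%N * gam) * M ^+ (\sum_(j | j != j0) #|cls E j|)%N by ring.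
  by rewrite ler_pM.
apply: (le_trans (lerD err1 (le_trans (ler_normB _ _) (lerD err2' err3')))).
have -> : 5 * M ^+ #|W| * gam + (10 * #|E|.-1%:R * M ^+ #|W| * gam + 5 * M ^+ #|W| * gam) =
  10 * (#|E|.-1%:R + 1) * M ^+ #|W| * gam by ring.
(* As [E] is nonempty, [#|E|.-1 + 1 = #|E|]; as [E'] is nonempty, this is at most [#|W|.-1]. *)
rewrite natr1 prednK//.
rewrite ler_wpM2r// ler_wpM2r ?exprn_ge0// ler_wpM2l// ler_nat.
by rewrite cW; case: #|E'| cE' => // e _; rewrite addnS/= leq_addr.
Qed.

End coloring.
End blocks.
End cocycle.

(** * Stretched exponentials, balls in an interval of integers, and set distance *)

(** Let [k = [q/3]]. If [k >= 1], then [q <= 3 * k + 3 <= 6 * k], and an exponent that is at most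
    both 1 and [eta] gives [6 * k ^ eta]. The summand 3 covers [k = 0], where [q <= 3]. *)
Lemma powR_third (R : realType) (q : nat) (eta : R) : 0 < eta -> (1 <= q)%N ->
  q%:R `^ Num.min eta 1 <= 6 * (Num.truncn (q%:R / 3%:R : R))%:R `^ eta + 3.
Proof.
move=> eta0 q1; set k := Num.truncn _; set th := Num.min eta 1.
have th0 : 0 <= th by rewrite le_min ler01 ltW.
have th1 : th <= 1 by rewrite ge_min lexx orbT.
have the : th <= eta by rewrite ge_min lexx.
have q1R : 1 <= q%:R :> R by rewrite ler1n.
have q3 : q%:R <= k%:R * 3 + 3 :> R.
  have : q%:R / 3%:R < k.+1%:R :> R by exact: truncnS_gt.
  by rewrite ltr_pdivrMr// -natr1 mulrDl mul1r => /ltW.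
have [k0|k0] := posnP k.
  rewrite k0 mul0r add0r in q3.
  apply: (@le_trans _ _ (q%:R : R)).
    by rewrite -[leRHS]powRr1// ler_powR.
  by apply: (le_trans q3); rewrite lerDr mulr_ge0// powR_ge0.
have k1 : 1 <= k%:R :> R by rewrite ler1n.
apply: (@le_trans _ _ ((6 * k%:R) `^ th)).
  apply: ge0_ler_powR; rewrite ?nnegrE//; lra.
rewrite powRM//.
apply: (@le_trans _ _ (6 * k%:R `^ eta)); last by rewrite lerDl.
apply: ler_pM; rewrite ?powR_ge0//; last exact: ler_powR.
by rewrite -[leRHS]powRr1// ler_powR// ler1n.
Qed.

(** The rate [a] is limited by [dlt / 3] for the exponential term and by [c2 / 6] for the mixing
    term, the 6 being that of [powR_third]. The factor [expR (3 * a)] in [d] absorbs the summand 3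
    there. *)
Lemma stretched_exponential (R : realType) (dlt c1 c2 eta : R) (al : nat -> R) :
  0 < dlt -> 0 < c1 -> 0 < c2 -> 0 < eta ->
  (forall k, al k <= c1 * expR (- c2 * k%:R `^ eta)) ->
  exists a d : R, [/\ 0 < a, 1 <= d & forall q : nat, (1 <= q)%N ->
    expR (- dlt * q%:R / 3) + al (Num.truncn (q%:R / 3%:R : R)) <=
    d * expR (- a * q%:R `^ Num.min eta 1)].
Proof.
move=> dlt0 c10 c20 eta0 hal.
pose a := Num.min (dlt / 3) (c2 / 6).
have a0 : 0 < a by rewrite lt_min !divr_gt0.
have a1 : a <= dlt / 3 by rewrite ge_min lexx.
have a2 : a <= c2 / 6 by rewrite ge_min lexx orbT.
exists a, (1 + c1 * expR (3 * a)); split => //.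
  by rewrite lerDl mulr_ge0 ?expR_ge0// ltW.
move=> q q1; rewrite mulrDl mul1r; apply: lerD.
  rewrite ler_expR; set th := Num.min eta 1.
  have qth : q%:R `^ th <= q%:R :> R.
    by rewrite -[leRHS]powRr1// ler_powR// ?ler1n// ge_min lexx orbT.
  have := ler_pM (ltW a0) (powR_ge0 _ _) a1 qth.
  by rewrite !mulNr lerN2 mulrAC.
apply: (le_trans (hal _)).
rewrite -mulrA ler_wpM2l ?(ltW c10)// -expRD ler_expR.
have := powR_third eta0 q1; set k := _ `^ eta => hk.
have k0 : 0 <= k by exact: powR_ge0.
have := ler_wpM2l (ltW a0) hk.
have := ler_wpM2r k0 a2; lra.
Qed.

Lemma card_ball n (i : 'I_n) (k : nat) :
  (#|[set u : 'I_n | (u != i) && (`|(u : nat)%:Z - (i : nat)%:Z| <= k)%N]%SET|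
    <= 2 * k)%N.
Proof.
set B := finset _.
have -> : #|B| = size [seq val u | u <- enum B] by rewrite size_map -cardE.
have szL : (size (iota (i - k) (i - (i - k)) ++ iota i.+1 k) <= 2 * k)%N.
  by rewrite size_cat !size_iota; lia.
apply: leq_trans szL; apply: uniq_leq_size.
  by rewrite (map_inj_uniq val_inj) enum_uniq.
move=> _ /seq.mapP[u + ->]; rewrite mem_enum inE => /andP[ui uk].
have ui' : (u : nat) <> i by move=> /val_inj/eqP; rewrite (negbTE ui).
by rewrite mem_cat !mem_iota /=; lia.
Qed.

Lemma card_ball_full n (i : 'I_n) (k : nat) :
  (#|[set u : 'I_n | (`|(u : nat)%:Z - (i : nat)%:Z| <= k)%N]%SET| <= (2 * k).+1)%N.
Proof.
rewrite (cardsD1 i) -add1n leq_add ?leq_b1//.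
apply: leq_trans (card_ball i k); apply: subset_leq_card.
by apply/fintype.subsetP => u; rewrite !inE.
Qed.

Lemma bigmin_le (I : finType) (A : {set I}) (F : I -> nat) (n : nat) a :
  a \in A -> (\big[minn/n]_(i in A) F i <= F a)%N.
Proof.
move=> aA; have : a \in index_enum I by exact: mem_index_enum.
elim: (index_enum I) => // x r IH; rewrite inE big_cons => /orP[/eqP <-|ar].
  by rewrite aA geq_minl.
by case: ifP => _; [rewrite geq_min IH ?orbT|exact: IH].
Qed.

Lemma setdist_le n (A B : {set 'I_n}) a c : a \in A -> c \in B ->
  (setdist A B <= `|(a : nat)%:Z - (c : nat)%:Z|)%N.
Proof.
move=> aA cB.
exact: leq_trans (bigmin_le _ _ aA) (@bigmin_le _ B _ n c cB).
Qed.

(** * Truncation of the observable and transfer back to [phi] *)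

Section clipped_observable.
Context {dX dY : measure_display} {X : measurableType dX}
  {Y : measurableType dY} {R : realType}.
Variables (m : probability X R) (v : (X -> R[i]) -> \bar R) (C : R).
Hypothesis hv : is_variation m v.
Hypothesis hC : forall g : X -> R[i], (normoo m g <= C%:E * bvnorm m v g)%E.
Variables (P : probability (paths Y) R).
Hypothesis hinv : shift_invariant P.
Variables (T : paths Y -> X -> X) (L : paths Y -> (X -> R[i]) -> X -> R[i]).
Hypothesis hTns : forall w, nonsingular m (T w).
Hypothesis hL : forall w, is_transfer m (T w) (L w).
Hypothesis hskew : measurable_fun setT (skew_map T).
Variables (N : paths Y -> R) (h : paths Y * X -> R).
Hypothesis hh : invariant_density m P v L h.
Variables (H : paths Y -> R) (mu : probability (paths Y * X)%type R).
Hypothesis hmu : is_mu m P h mu.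
Variables (lambda eps' eps : R) (D Dt K : paths Y -> R).
Hypothesis hdecay : decay m P v L h lambda eps' D Dt.
Hypothesis hK : slow_variation P eps D Dt N H K.
Variable phi : paths Y * X -> R.
Hypothesis mphi : measurable_fun setT phi.
Hypothesis hphiK : (ess_sup_K m P v K phi < +oo)%E.

Local Notation bvnorm := (bvnorm m v).
Local Notation tau := (skew_map T).

Let rho0 := fine (ess_sup_K m P v K phi).
Let B := C * rho0.

(* Truncation makes the observable bounded everywhere without changing it
   almost everywhere. *)
Definition clip z : R := Num.max (- B) (Num.min (phi z) B).

Let K1 w : 1 < K w. Proof. by case: hK => _ /(_ w). Qed.

Let K0 w : 0 < K w. Proof. exact: lt_trans ltr01 (K1 w). Qed.

Let C1 : 1 <= C. Proof. exact: normoo_const_ge1 hv hC. Qed.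

Lemma ess_sup_K_ge0 : (0 <= ess_sup_K m P v K phi)%E.
Proof.
have P0 : (0 < P [set: paths Y])%E by rewrite (probability_setT P) lte01.
apply: ess_sup_gee; first exact: P0.
by apply: aeW => w; rewrite mule_ge0 ?lee_fin ?(ltW (K0 w))// bvnorm_ge0.
Qed.

Lemma ess_sup_K_fin : ess_sup_K m P v K phi = rho0%:E.
Proof. by rewrite /rho0 fineK// ge0_fin_numE// ess_sup_K_ge0. Qed.

Lemma rho0_ge0 : 0 <= rho0.
Proof. by rewrite -lee_fin -ess_sup_K_fin ess_sup_K_ge0. Qed.

Lemma bvnorm_phi_ae : {ae P, forall w,
  (bvnorm (real_fun (fun x => phi (w, x))) <= (rho0 / K w)%:E)%E}.
Proof.
have := ess_sup_ge P (fun w => (K w)%:E * bvnorm (real_fun (fun x => phi (w, x))))%E.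
rewrite -/(ess_sup_K m P v K phi) ess_sup_K_fin.
by apply: filterS => w; rewrite muleC EFinM -lee_pdivlMr.
Qed.

Let B_ge0 : 0 <= B.
Proof. by rewrite mulr_ge0 ?rho0_ge0// (le_trans ler01). Qed.

Lemma phi_bound_ae :
  {ae P, forall w, {ae m, forall x, `|phi (w, x)| <= B}}.
Proof.
apply: filterS bvnorm_phi_ae => w hw.
have : (normoo m (real_fun (fun x => phi (w, x))) <= B%:E)%E.
  apply: (le_trans (hC _)); rewrite /B EFinM; apply: lee_wpmul2l.
    by rewrite lee_fin (le_trans ler01).
  apply: (le_trans hw); rewrite lee_fin ler_pdivrMr// ler_peMr ?rho0_ge0//.
  exact: ltW.
by move/normoo_leP; apply: filterS => x; rewrite normc_real.
Qed.

Lemma clip_id z : `|phi z| <= B -> clip z = phi z.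
Proof.
rewrite ler_norml => /andP[h1 h2].
by rewrite /clip min_l// max_r.
Qed.

Lemma norm_clip z : `|clip z| <= B.
Proof.
have NB : - B <= B by rewrite (le_trans _ B_ge0)// oppr_le0.
by rewrite ler_norml /clip le_max lexx/= ge_max NB ge_min lexx orbT.
Qed.

Lemma measurable_clip : measurable_fun setT clip.
Proof.
apply: measurable_maxr => //; exact: measurable_minr.
Qed.

Lemma orbit_good_ae : {ae P, forall w, orbit_good m v L h K lambda eps rho0 clip w}.
Proof.
apply: (ae_shift hinv).
have [[[_ D0] _] _ hdec] := hdecay; have [_ _ hKt hKs] := hK.
have hb := bvnorm_phi_ae.
have D' : {ae P, forall w, D w <= K w /\
    forall n : int, K w * expR (- eps * `|n|%:~R) <= K (shift n w)}.
  apply: filterS2 hKt hKs => w /andP[_ h1] h2; split.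
    by apply: le_trans h1; rewrite !le_max lexx.
  by move=> n; case/andP: (h2 n).
have hd := density_int1 hh; have h0 := density_ge0 hh.
have he := density_equivariant hh.
have mh := density_measurable hh.
have hphi := phi_bound_ae.
have Q1 : {ae P, forall w, [/\ D w <= K w /\
    (forall n : int, K w * expR (- eps * `|n|%:~R) <= K (shift n w)),
    (\int[m]_x (fiber h w x)%:E = 1)%E & {ae m, forall x, 0 <= fiber h w x}]}.
  by apply: filterS3 D' hd h0.
have Q2 : {ae P, forall w, [/\ {ae m, forall x,
      L w (real_fun (fiber h w)) x = real_fun (fiber h (shift 1 w)) x},
    {ae m, forall x, `|phi (w, x)| <= B} &
    (bvnorm (real_fun (fun x => phi (w, x))) <= (rho0 / K w)%:E)%E]}.
  by apply: filterS3 he hphi hb.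
apply: filterS3 Q1 Q2 hdec => w [[DK Kn] int1 ge0] [eqv pB pb] dec.
have n1 : BV m v (fun=> 1).
  by apply: (@bvnorm_leP _ _ _ _ _ _ 1); rewrite (bvnorm_cst1 hv).
have cint1 : cint m (fun=> 1) = 1.
  rewrite /cint /=; congr Complex.
    by rewrite Rintegral_cst_prob.
  by rewrite Rintegral_cst_prob.
split.
- move=> n g b gb; have [d1 _ _ _] := dec n.
  apply: (le_trans (d1 g (bvnorm_leP gb))); rewrite [leRHS]EFinM.
  have e0 : 0 <= expR (- lambda * n%:R) by exact: expR_ge0.
  apply: lee_pmul gb; rewrite ?(bvnorm_ge0 hv)// lee_fin.
    by rewrite mulr_ge0// ltW.
  by rewrite ler_wpM2r.
(* The bound on the density comes from the second decay estimate at [n = 0] on the constant 1: since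
   [1 - Pi_op 1] is the density, its [BV] norm is at most [D w <= K w]. *)
- have [_ d2 _ _] := dec 0%N.
  have := d2 _ n1; rewrite (bvnorm_cst1 hv) mule1 mulr0 expR0 mulr1 /=.
  have -> : (fun=> 1) \- Pi_op m h w (fun=> 1) = real_fun (fiber h w).
    by apply/funext => x; rewrite /= /Pi_op cint1 mul1r opprB addrCA subrr addr0.
  by move=> /le_trans; apply; rewrite lee_fin.
- exact: ge0.
- by rewrite /Rintegral int1.
- exact: eqv.
- move=> n; have := Kn n%:Z; rewrite ger0_norm// -pmulrn => hn.
  by rewrite -ler_pdivrMr ?expR_gt0// -expRN -mulNr.
- apply: (bvnorm_ae_le hv _ _ pb).
    by apply/cmeasurable_real_fun/measurable_fiber; exact: measurable_clip.
  by apply: filterS pB => x hx; rewrite /real_fun clip_id.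
Qed.

Let mh : measurable_fun setT h. Proof. exact: density_measurable hh. Qed.

(** The exceptional set is null on almost every fibre; integrating its indicator with [mixture_mean]
    makes it [mu]-null. *)
Lemma clip_ae : {ae mu, forall z, clip z = phi z}.
Proof.
have mN : measurable [set z | B < `|phi z|].
  have -> : [set z | B < `|phi z|] = (fun z => `|phi z|) @^-1` `]B, +oo[.
    by apply/seteqP; split => x /=; rewrite in_itv/= andbT.
  rewrite -[X in measurable X]setTI.
  apply: (measurableT_comp (@normr_measurable R setT) mphi) => //.
exists [set z | B < `|phi z|]; split => //.
  have E : fine (mu [set z | B < `|phi z|]) = \int[mu]_z \1_[set z | B < `|phi z|] z.
    by rewrite /Rintegral integral_indic// setIT.
  have m1 : measurable_fun setT (\1_[set z | B < `|phi z|] : paths Y * X -> R).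
    exact: measurable_indic.
  have b1 z : `|(\1_[set z | B < `|phi z|] z : R)| <= 1.
    by rewrite indicE; case: (_ \in _); rewrite ?normr1 ?normr0.
  have I0 : fine (mu [set z | B < `|phi z|]) = 0.
    rewrite E (mixture_mean mh orbit_good_ae hmu m1 b1).
    apply/eqP; rewrite -normr_le0; apply: le_norm_Rintegral_ae.
      exact: (measurable_fiber_integral mh orbit_good_ae m1 b1).
    apply: filterS phi_bound_ae => w hw; apply: le_norm_Rintegral_ae.
      by apply: measurable_funM; apply: measurable_fiber.
    apply: filterS hw => x hx; rewrite indicE memNset ?mulr0 ?normr0//=.
    by apply/negP; rewrite -leNgt.
  by rewrite -[LHS]fineK ?I0// fin_num_measure.
move=> z /=; apply: contra_notP => /negP; rewrite -leNgt; exact: clip_id.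
Qed.

Lemma iter_skew_preserves n A : measurable A -> mu (iter n tau @^-1` A) = mu A.
Proof.
move=> mA; have mn := measurable_iter n hskew.
have mnA : measurable (iter n tau @^-1` A) by rewrite -[X in measurable X]setTI; exact: mn.
have E (A' : set (paths Y * X)) : measurable A' -> fine (mu A') = \int[mu]_z \1_A' z.
  by move=> mA'; rewrite /Rintegral integral_indic// setIT.
have b1 z : `|(\1_A z : R)| <= 1.
  by rewrite indicE; case: (_ \in _); rewrite ?normr1 ?normr0.
rewrite -[LHS]fineK ?fin_num_measure// -[RHS]fineK ?fin_num_measure//.
rewrite !E//; congr EFin.
have m1 : measurable_fun setT (\1_A : paths Y * X -> R) by exact: measurable_indic.
rewrite -(mixture_invariant hTns hL mh hskew hinv orbit_good_ae hmu n m1 b1).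
by apply: eq_Rintegral.
Qed.

Lemma clip_iter_ae :
  {ae mu, forall z, forall n, clip (iter n tau z) = phi (iter n tau z)}.
Proof.
apply: ae_foralln => n; apply: ae_preserving clip_ae.
- exact: measurable_iter.
- exact: iter_skew_preserves.
Qed.

Lemma expectation_ae_bounded (f g : paths Y * X -> R) (M : R) :
  measurable_fun setT f -> measurable_fun setT g -> (forall z, `|g z| <= M) ->
  {ae mu, forall z, g z = f z} -> ('E_mu[f] = (\int[mu]_z g z)%R%:E)%E.
Proof.
move=> mf mg gM gf; rewrite unlock /Rintegral fineK; last first.
  apply: integrable_fin_num => //; exact: bounded_integrable gM.
apply: ae_eq_integral => //; try exact/measurable_EFinP.
by apply: filterS gf => z ->.
Qed.

Lemma expectation_iter n : ('E_mu[fun z => phi (iter n tau z)] = 'E_mu[phi])%E.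
Proof.
have mn := measurable_iter n hskew; have mc := measurable_clip.
rewrite (expectation_ae_bounded (g := fun z => clip (iter n tau z)) (M := B)).
- rewrite (expectation_ae_bounded mphi mc norm_clip clip_ae); congr EFin.
  exact: (mixture_invariant hTns hL mh hskew hinv orbit_good_ae hmu n mc norm_clip).
- exact: (measurableT_comp mphi mn).
- exact: (measurableT_comp mc mn).
- by move=> z; exact: norm_clip.
- by apply: filterS clip_iter_ae => z.
Qed.

Lemma normoo_iter n : ('N[mu]_+oo[EFin \o (fun z => phi (iter n tau z))] <= B%:E)%E.
Proof.
have mu0 : (0 < mu [set: paths Y * X])%E by rewrite (probability_setT mu) lte01.
rewrite unlock /=.
have -> : (if (0 < mu [set: paths Y * X])%E
    then ess_sup mu (abse \o (EFin \o (fun z => phi (iter n tau z)))) else 0%E) =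
    ess_sup mu (abse \o (EFin \o (fun z => phi (iter n tau z)))) by rewrite ifT.
apply/ess_supP; apply: filterS clip_iter_ae => z hz.
by rewrite /= lee_fin -hz norm_clip.
Qed.

Lemma expectation_block n (V : {set 'I_n}) :
  ('E_mu[fun z => (\prod_(i in V) phi (iter i tau z))%R] =
   (block_mean T clip mu V)%:E)%E.
Proof.
apply: (expectation_ae_bounded (M := B ^+ #|V|)).
- exact: (measurable_block_obs mphi hskew V).
- exact: (measurable_block_obs measurable_clip hskew V).
- by move=> z; apply: norm_block_obs; exact: norm_clip.
- apply: filterS clip_iter_ae => z hz.
  by rewrite /block_obs; apply: eq_bigr => i _.
Qed.

Hypothesis hT0 : forall w w' : paths Y, w 0 = w' 0 -> T w = T w'.
Hypothesis hphi0 : forall (w w' : paths Y) x, w 0 = w' 0 -> phi (w, x) = phi (w', x).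
Hypothesis hle : eps < lambda.
Context {dS : measure_display} {S : measurableType dS}.
Variables (PP : probability S R) (xi : int -> S -> Y).
Hypothesis hxi : forall j, measurable_fun setT (xi j).
Hypothesis hP : is_law PP xi P.

Lemma blocks_decorrelation n (b : R) (J : finType) (A : J -> {set 'I_n}) :
  0 < b -> (forall j, A j != finset.set0) ->
  (forall i j, i != j -> b <= (setdist (A i) (A j))%:R) ->
  forall r, r = (\sum_(j : J) #|A j|)%N ->
  (`| 'E_mu[fun z => (\prod_(j : J) \prod_(i in A j) phi (iter i tau z))%R]
     - \prod_(j : J) 'E_mu[fun z => (\prod_(i in A j) phi (iter i tau z))%R] |
   <= (10 * r.-1%:R * (6 * C ^+ 2 * rho0) ^+ r * gamma_ PP xi lambda eps b)%:E)%E.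
Proof.
move=> b0 A0 hA r rE.
have gam0 : 0 <= gamma_ PP xi lambda eps b by exact: (gamma_ge0 PP hxi lambda eps b).
have sep i j x y : x \in A i -> y \in A j -> i != j ->
    b <= `|(x : nat)%:Z - (y : nat)%:Z|%N%:R.
  move=> xi' yj ij; apply: (le_trans (hA i j ij)); rewrite ler_nat.
  exact: setdist_le.
(* Positivity of [b] makes the blocks disjoint, so the double product is a product over their union
   and every point of it has a single color. *)
have disj i j : i != j -> [disjoint A i & A j]%bool.
  move=> ij; apply/pred0P => x /=; apply/negP => /andP[xi' xj].
  by have := sep _ _ _ _ xi' xj ij; rewrite subrr /= leNgt b0.
pose W := (\bigcup_(j : J) A j)%SET.
have rW : r = #|W|.
  by rewrite rE -sum1_card partition_disjoint_bigcup//; apply: eq_bigr => j _; rewrite sum1_card.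
have EW : (fun z => \prod_(j : J) \prod_(i in A j) phi (iter i tau z)) =
    (fun z => \prod_(i in W) phi (iter i tau z)).
  by apply/funext => z; rewrite partition_disjoint_bigcup.
rewrite EW expectation_block.
under eq_bigr do rewrite expectation_block.
rewrite prodEFin -EFinB abse_EFin lee_fin rW.
have [W0|/set0Pn[x0 x0W]] := eqVneq W finset.set0.
  have J0 (j : J) : False.
    have /set0Pn[x xj] := A0 j; have : x \in W by apply/finset.bigcupP; exists j.
    by rewrite W0 inE.
  rewrite W0 cards0 mulr0 !mul0r big1; last by move=> j; have := J0 j.
  by rewrite (block_mean0 T clip mu n) subrr normr0.
have [j0 _ x0j] := finset.bigcupP x0W.
(* The default [j0] is taken only outside [W]. *)
pose kappa x := odflt j0 [pick j | x \in A j].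
have kapE x j : x \in A j -> kappa x = j.
  move=> xj; rewrite /kappa; case: pickP => [k xk|/(_ j)]; last by rewrite xj.
  apply/eqP/negPn/negP => kj; have /pred0P/(_ x)/= := disj _ _ kj.
  by rewrite xk xj.
have clsE j : [set x in W | kappa x == j]%SET = A j.
  apply/finset.setP => x; rewrite inE; apply/andP/idP => [[xW /eqP <-]|xj].
    by have [k _ xk] := finset.bigcupP xW; rewrite (kapE _ _ xk).
  by rewrite (kapE _ _ xj) eqxx; split=> //; apply/finset.bigcupP; exists j.
under eq_bigr do rewrite -clsE.
apply: (coloring_decorrelation hv hC hTns hL hle measurable_clip norm_clip mh K1
  rho0_ge0 hskew hinv orbit_good_ae hmu (erefl _) hT0 _ hxi hP b0).
- by move=> w w' x ww'; rewrite /clip (hphi0 x ww').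
- move=> x y xW yW kxy.
  have [j _ xj] := finset.bigcupP xW; have [k _ yk] := finset.bigcupP yW.
  by apply: (sep _ _ _ _ xj yk); rewrite -(kapE _ _ xj) -(kapE _ _ yk).
Qed.

End clipped_observable.

(** * The constant [A0], the decorrelation bound and its companion conditions *)

Local Open Scope ereal_scope.

Theorem proposition3p4 (R : realType) :
  exists A0 : R -> R -> R,
  (forall l C : R, (0 < A0 l C)%R) /\
  forall (dX dY dS : measure_display)
    (X : measurableType dX) (Y : measurableType dY) (S : measurableType dS)
    (* the space X, its variation, and the constant C *)
    (m : probability X R) (v : (X -> R[i]) -> \bar R) (C : R)
    (hv : is_variation m v)
    (hC : forall g : X -> R[i], normoo m g <= C%:E * bvnorm m v g)
    (* the stationary process and the base system *)
    (PP : probability S R) (xi : int -> S -> Y)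
    (hxi : forall j, measurable_fun setT (xi j))
    (hstat : stationary PP xi)
    (P : probability (paths Y) R) (hP : is_law PP xi P)
    (hinv : shift_invariant P) (herg : shift_ergodic P)
    (* the random maps and their transfer operators *)
    (T : paths Y -> X -> X)
    (hT0 : forall w w' : paths Y, w 0%R = w' 0%R -> T w = T w')
    (hTns : forall w, nonsingular m (T w))
    (hskew : measurable_fun setT (skew_map T))
    (L : paths Y -> (X -> R[i]) -> X -> R[i])
    (hL : forall w, is_transfer m (T w) (L w))
    (hgood : good_cocycle m P v T L)
    (N : paths Y -> R) (hN : composition_bound m P v T N)
    (* the equivariant density, the measure mu, the rates, and K *)
    (h : paths Y * X -> R) (hh : invariant_density m P v L h)
    (H : paths Y -> R) (hH : inverse_norm m P v h H)
    (mu : probability (paths Y * X)%type R) (hmu : is_mu m P h mu)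
    (lambda eps' eps : R) (D Dt K : paths Y -> R)
    (hlambda : (0 < lambda)%R) (heps' : (0 < eps')%R)
    (hdecay : decay m P v L h lambda eps' D Dt)
    (heps0 : (0 < eps)%R) (heps1 : (eps < lambda / 3)%R)
    (hK : slow_variation P eps D Dt N H K)
    (* the observable *)
    (phi : paths Y * X -> R)
    (hphi_meas : measurable_fun setT phi)
    (hphi_int : 'E_mu[phi] = 0)
    (hphi0 : forall (w w' : paths Y) (x : X),
       w 0%R = w' 0%R -> phi (w, x) = phi (w', x))
    (hphiK : ess_sup_K m P v K phi < +oo)
    (n : nat),
  let Xv (i : 'I_n) : paths Y * X -> R := fun z => phi (iter i (skew_map T) z) in
  let dist (i j : 'I_n) : nat := `|(i : nat)%:Z - (j : nat)%:Z|%N in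
  let varrho : R := (A0 (lambda - 3 * eps) C *
    Num.max (fine (ess_sup_K m P v K phi))
            (fine 'N[mu]_+oo[EFin \o phi]))%R in
  let varrho_ (i : 'I_n) : R := varrho in
  let gam : R -> R := gamma_ PP xi lambda eps in
  (forall (k : nat) (b : R) (J : finType) (A : J -> {set 'I_n}),
     (1 <= k)%N -> (0 < b)%R -> (0 < #|J|)%N ->
     (forall j, A j != finset.set0) ->
     (forall i j, i != j -> (b <= (setdist (A i) (A j))%:R)%R) ->
     let r : nat := (\sum_(j : J) #|A j|)%N in
     (r <= k)%N ->
     `| 'E_mu[(fun z => (\prod_(j : J) \prod_(i in A j) Xv i z)%R)]
        - \prod_(j : J) 'E_mu[(fun z => (\prod_(i in A j) Xv i z)%R)] |
       <= ((r%:R - 1) * (\prod_(j : J) \prod_(i in A j) varrho_ i)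
             * gam b)%R%:E
     /\ ((r%:R - 1) * (\prod_(j : J) \prod_(i in A j) varrho_ i) * gam b
         = (r%:R - 1) * varrho ^+ r * gam b)%R)
  /\
  (forall c1 c2 eta : R, (0 < c1)%R -> (0 < c2)%R -> (0 < eta)%R ->
     (forall k : nat, (alpha PP xi k <= c1 * expR (- c2 * k%:R `^ eta))%R) ->
     [/\ forall i : 'I_n, measurable_fun setT (Xv i) /\ 'E_mu[Xv i] = 0,
         forall i : 'I_n, 'N[mu]_+oo[EFin \o Xv i] <= (varrho_ i)%:E,
         (* 3 in place of 2, resp. 2 for the punctured ball: the ball of
            radius 1 around an interior point has three elements *)
         forall (i : 'I_n) (s : R), (1 <= s)%R ->
           (#|[set u : 'I_n | ((dist u i)%:R <= s)%R]%SET|%:R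
              <= 3 * s `^ 1)%R /\
           (#|[set u : 'I_n | (u != i) && ((dist u i)%:R <= s)%R]%SET|%:R
              <= 2 * s `^ 1)%R
       & (* min(eta, 1) is eta when eta <= 1; the summand
            expR (- (lambda - eps) * q / 3) of gamma_q excludes eta > 1 *)
         exists a d : R, [/\ (0 < a)%R, (1 <= d)%R &
           forall k q : nat, (1 <= k)%N -> (1 <= q)%N ->
             (\big[Num.max/0]_(1 <= r < k.+1) (gam q%:R / r%:R)
                <= d * expR (- a * q%:R `^ Num.min eta 1))%R]]).
Proof.
(* [60 = 10 * 6]: the 10 of the induction times the 6 of the per-point constant [6 * C ^+ 2 * rho0].
   The summand 1 keeps the value positive for every real [C]. *)
exists (fun _ C => 60 * (1 + C ^+ 2))%R; split=> [l C|].
  by rewrite mulr_gt0// ltr_wpDr// sqr_ge0.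
move=> dX dY dS X Y S m v C hv hC PP xi hxi hstat P hP hinv herg T hT0 hTns hskew
  L hL hgood N hN h hh H hH mu hmu lambda eps' eps D Dt K hlambda heps' hdecay
  heps0 heps1 hK phi mphi hphi_int hphi0 hphiK n Xv dist varrho varrho_ gam.
pose rho0 := fine (ess_sup_K m P v K phi).
have r0 : (0 <= rho0)%R by exact: (rho0_ge0 hv hK hphiK).
have hle : (eps < lambda)%R by lra.
have C1 : (1 <= C)%R by exact: (normoo_const_ge1 hv hC).
have max0 : (rho0 <= Num.max rho0 (fine 'N[mu]_+oo[EFin \o phi]))%R.
  by rewrite le_max lexx.
have C2 : (0 <= C ^+ 2)%R by exact: sqr_ge0.
have bigM : (10 * (6 * C ^+ 2 * rho0) <= varrho)%R.
  have -> : (10 * (6 * C ^+ 2 * rho0) = 60 * C ^+ 2 * rho0)%R by ring.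
  by rewrite /varrho; apply: ler_pM; [lra|exact: r0|lra|exact: max0].
have CB : (C * rho0 <= varrho)%R.
  have CC : (C <= C ^+ 2)%R by rewrite expr2 ler_peMl// (le_trans _ C1).
  by rewrite /varrho; apply: ler_pM; [lra|exact: r0|lra|exact: max0].
have gam0 b : (0 <= gam b)%R by exact: (gamma_ge0 PP hxi lambda eps b).
split=> [k b J A k1 b0 J0 A0 hA r rk|c1 c2 eta c10 c20 eta0 halpha].
  have prodE : (\prod_(j : J) \prod_(i in A j) varrho_ i = varrho ^+ r)%R.
    by rewrite /r expr_sum; apply: eq_bigr => j _; rewrite prodr_const.
  rewrite prodE; split=> //.
  have rpos : (0 < r)%N.
    have /card_gt0P[j _] := J0.
    by rewrite /r (bigD1 j)//= ltn_addr// card_gt0.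
  have main := blocks_decorrelation hv hC hinv hTns hL hskew hh hmu hdecay hK mphi
    hphiK hT0 hphi0 hle hxi hP b0 A0 hA (erefl _).
  apply: (le_trans main); rewrite lee_fin ler_wpM2r//.
  have -> : (r%:R - 1 = r.-1%:R :> R)%R.
    by rewrite -[in LHS](prednK rpos) -natr1 addrK.
  rewrite -/r; set M := (6 * C ^+ 2 * rho0)%R in bigM *.
  have -> : (10 * r.-1%:R * M ^+ r = r.-1%:R * (10 * M ^+ r))%R by ring.
  apply: ler_wpM2l => //.
  have M0 : (0 <= M)%R by apply: mulr_ge0 r0; apply: mulr_ge0 C2.
  (* The single factor 10 is paid at every point; as [r >= 1], this is a weakening, and it moves 10
     into [varrho]. *)
  apply: (@le_trans _ _ ((10 * M) ^+ r)%R); last first.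
    have M10 : (0 <= 10 * M)%R by exact: mulr_ge0.
    by apply: lerXn2r; rewrite ?nnegrE// (le_trans M10 bigM).
  rewrite [leRHS]exprMn ler_wpM2r ?exprn_ge0//.
  by rewrite -[leLHS]expr1 ler_weXn2l// ler1n.
split.
- move=> i; split.
    exact: (measurableT_comp mphi (measurable_iter i hskew)).
  by rewrite (expectation_iter hv hC hinv hTns hL hskew hh hmu hdecay hK mphi hphiK).
- move=> i; apply: (le_trans (normoo_iter hv hC hinv hTns hL hskew hh hmu hdecay hK
    mphi hphiK i)).
  by rewrite lee_fin.
- move=> i s s1; have s0 : (0 <= s)%R by lra.
  rewrite powRr1//; set q := Num.truncn s.
  have qs : (q%:R <= s)%R by have /andP[] := truncn_itv s0.
  have sq (u : nat) : ((u%:R <= s) = (u <= q)%N)%R by rewrite truncn_ge_nat.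
  have q1 : (1 <= q)%N by rewrite -sq.
  split.
    have := card_ball_full i q; rewrite -(ler_nat R).
    have -> : [set u : 'I_n | ((dist u i)%:R <= s)%R]%SET =
        [set u : 'I_n | (`|(u : nat)%:Z - (i : nat)%:Z| <= q)%N]%SET.
      by apply/finset.setP => u; rewrite !inE sq.
    (* Here [2 * q + 1 <= 3 * q] because [s >= 1] forces [q >= 1]. *)
    move=> /le_trans; apply; apply: (@le_trans _ _ (3 * q%:R)%R).
      by rewrite -natrM ler_nat (mulSn 2) -add1n leq_add2r.
    by rewrite ler_wpM2l.
  have := card_ball i q; rewrite -(ler_nat R).
  have -> : [set u : 'I_n | (u != i) && ((dist u i)%:R <= s)%R]%SET =
      [set u : 'I_n | (u != i) && (`|(u : nat)%:Z - (i : nat)%:Z| <= q)%N]%SET.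
    by apply/finset.setP => u; rewrite !inE sq.
  by move=> /le_trans; apply; rewrite natrM ler_wpM2l.
- have dlt0 : (0 < lambda - eps)%R by lra.
  have [a [d [a0 d1 had]]] := stretched_exponential dlt0 c10 c20 eta0 halpha.
  exists a, d; split=> // k q k1 q1.
  (* This handles the initial value 0 of the maximum; in its terms, division by [r >= 1] only
     decreases the nonnegative [gam q]. *)
  have Y0 : (0 <= d * expR (- a * q%:R `^ Num.min eta 1))%R.
    by rewrite mulr_ge0 ?expR_ge0//; lra.
  rewrite big_nat; apply: (big_ind (fun x => x <= _)%R) => //.
    by move=> x y xY yY; rewrite ge_max xY yY.
  move=> j /andP[j1 _]; apply: le_trans (had q q1).
  by rewrite ler_pdivrMr ?ltr0n// ler_peMr// ?gam0// ler1n.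
Qed.
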